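(* Let $(\Omega, \mathcal{F}, \mathbb{F}, \mathbf{P})$ be a filtered probability space with filtration $\mathbb{F} = (\mathcal{F}_t)_{t \in [0,\infty)}$, and let $X = (X_t)_{t \in [0,\infty)}$ be a real-valued, progressively measurable, almost surely right-continuous process. Then the following three statements are equivalent: (I) $X$ is a uniformly integrable martingale. (II) $X_\infty = \lim_{t \uparrow \infty} X_t$ exists, and $X_\tau \in L^1$ and $\mathbb{E}[X_\tau] = \mathbb{E}[X_0]$ for all stopping times $\tau$ (possibly taking the value $\infty$). (III) $X_\tau \in L^1$ and $\mathbb{E}[X_\tau] = \mathbb{E}[X_0]$ for all finite stopping times $\tau$, and $\liminf_{t \uparrow \infty} |X_t| \in L^1$.
   Context: The filtration satisfies $\mathcal{F}_\infty = \bigvee_{t \in [0,\infty)} \mathcal{F}_t \subset \mathcal{F}$; it is not assumed to be right-continuous or complete. Martingales, stopping times and progressive measurability are with respect to $\mathbb{F}$. Stopping times take values in $[0,\infty]$; $\mathbb{E}$ is expectation under $\mathbf{P}$; $Z \in L^1$ means $\mathbb{E}[|Z|] < \infty$. All identifications and statements are understood in the almost-sure sense; in particular, limits exist almost surely, and a finite stopping time is one with $\tau < \infty$ almost surely. On $\{\tau = \infty\}$, $X_\tau$ means $X_\infty$. *)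

(* Defs.v *)
From HB Require Import structures.
From mathcomp Require Import all_boot all_order all_algebra.
From mathcomp Require Import all_classical all_reals all_analysis.

Set Implicit Arguments.
Unset Strict Implicit.
Unset Printing Implicit Defensive.

Import Order.TTheory GRing.Theory Num.Theory.
Import numFieldNormedType.Exports.

Local Open Scope classical_set_scope.
Local Open Scope ring_scope.

(* The time set [0, +oo) is rendered by R together with the guard 0 <= t: the
   values of filtrations and processes at negative times are never used. *)

Section defs.
Context (d : measure_display) (T : measurableType d) (R : realType).
Implicit Types (P : probability T R) (F : R -> set (set T)).
Implicit Types (X : R -> T -> R) (tau : T -> \bar R).

Definition filtration F : Prop :=
  (forall t : R, 0 <= t -> sigma_algebra setT (F t) /\ F t `<=` measurable) /\
  (forall s t : R, 0 <= s -> s <= t -> F s `<=` F t).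

(* Since F t is a sigma-algebra, g_sigma_algebraType (F t) is T with F t as its
   measurable sets, and the product carries the product sigma-algebra
   B(R) (x) F t, whose trace on [0, t] x T is B([0, t]) (x) F t. *)
Definition progressive F X : Prop :=
  forall t : R, 0 <= t ->
    measurable_fun (`[0, t]%classic `*` [set: g_sigma_algebraType (F t)])
      (fun p : R * g_sigma_algebraType (F t) => X p.1 p.2).

Definition as_right_continuous P X : Prop :=
  {ae P, forall w, forall t : R, 0 <= t -> X s w @[s --> t^'+] --> X t w}.

Definition adapted F X : Prop :=
  forall t : R, 0 <= t ->
    measurable_fun setT (X t : g_sigma_algebraType (F t) -> R).

(* Z is a version of the conditional expectation of Y given G. *)
Definition is_cond_expectation P (G : set (set T)) (Y Z : T -> R) : Prop :=
  [/\ measurable_fun setT (Z : g_sigma_algebraType G -> R),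
      P.-integrable setT (EFin \o Z) &
      forall A, G A ->
        (\int[P]_(w in A) (Z w)%:E = \int[P]_(w in A) (Y w)%:E)%E].

Definition martingale P F X : Prop :=
  [/\ adapted F X,
      forall t : R, 0 <= t -> P.-integrable setT (EFin \o X t) &
      forall s t : R, 0 <= s -> s <= t -> is_cond_expectation P (F s) (X t) (X s)].

Definition uniformly_integrable P X : Prop :=
  ereal_sup [set (\int[P]_(w in [set w | (c < `|X t w|)%R]) `|X t w|%:E)%E
            | t in [set t : R | 0 <= t]]
    @[c --> +oo%R] --> 0%E.

Definition stopping_time F tau : Prop :=
  (forall w, 0 <= tau w)%E /\
  (forall t : R, 0 <= t -> F t [set w | (tau w <= t%:E)%E]).

Definition finite_stopping_time P F tau : Prop :=
  stopping_time F tau /\ {ae P, forall w, (tau w < +oo)%E}.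

Definition limit_exists P X : Prop :=
  {ae P, forall w, cvg (X t w @[t --> +oo%R])}.

(* lim is a total operator: X_infty takes a junk value where the limit does not
   exist. *)
Definition X_infty X (w : T) : R := lim (X t w @[t --> +oo%R]).

Definition stopped X tau (w : T) : R :=
  if tau w is r%:E then X r w else X_infty X w.

(* X_infty and the pathwise liminf need not be measurable, since the underlying
   sigma-algebra need not be complete and only almost every path is
   right-continuous. Membership in L^1 and the expectation of such a Z are
   therefore those of a measurable function that is almost surely equal to Z;
   the choice of that function is irrelevant. *)
Definition in_L1 P (Z : T -> \bar R) : Prop :=
  exists2 Y : T -> \bar R,
    P.-integrable setT Y & {ae P, forall w, Z w = Y w}.

Definition in_L1_with_mean P (Z : T -> R) (m : \bar R) : Prop :=
  exists Y : T -> R,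
    [/\ P.-integrable setT (EFin \o Y),
        {ae P, forall w, Z w = Y w} & 'E_P[Y] = m]%E.

Definition liminf_abs X (w : T) : \bar R :=
  limf_einf (fun t : R => `|X t w|%:E) (pinfty_nbhs R).

End defs.

(* Main.v *)
Require Import Defs.
From HB Require Import structures.
From mathcomp Require Import all_boot all_order all_algebra.
From mathcomp Require Import all_classical all_reals all_analysis.
From mathcomp Require Import measurable_realfun lra.
Import Order.TTheory GRing.Theory Num.Theory.
Import numFieldNormedType.Exports.
Local Open Scope classical_set_scope.
Local Open Scope ring_scope.

Set Implicit Arguments.
Unset Strict Implicit.

(** Why the three statements are equivalent: I implies II, II implies III and
    III implies I.

    From III to I.  If X has the same mean at all finite stopping times, then
    stopping at s on an event A of F s, and at t >= s elsewhere, has the same mean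
    as stopping at t; hence X s and X t have the same mean on A, and X is a
    martingale ([switch_mean]).  For uniform integrability, it is enough to find a
    single integrable D and, for each t, a finite stopping time sigma >= t with
    |X sigma| <= D.  Switching from sigma to t on events of F t then shows that
    |X t| is at most the conditional mean of D ([dominated_ui]).  The limit
    inferior L of |X| provides D and sigma ([liminf_domination]).  Split the time
    axis into consecutive blocks, and let m k be the minimum of |X| over a finite
    grid of the k-th block.  If the grids are fine enough, m k <= L + e k where the
    means of the errors e k are summable, so that m k tends to L almost surely.
    The event that |X| <= m k + 1 at a time of the grid k + 1 is known at that time,
    and occurs for some k almost surely.  Thus the first such time after t is a
    finite stopping time, at which |X| <= L + (the sum of the e k) + 1 =: D.

    From I to II.  A uniformly integrable martingale is Cauchy in L1, without any
    upcrossing argument: the mean of (X t - a)^+ is bounded and nondecreasing in t,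
    and its increase from s to t is the mean of a nonnegative quantity that is
    large when the level a separates X s from X t.  Summing over a finite grid of
    levels a bounds the L1 distance from X s to X t ([cond_mean_dist],
    [martingale_L1_cauchy]).  Doob's maximal inequality makes almost every path
    Cauchy at infinity ([maximal_dyadic]), and the limit Z closes the martingale:
    X t is the conditional mean of Z given F t ([ui_martingale_closed]).  Given a
    stopping time tau, approximate it from the right by stopping times with
    countably many values.  At these, X has the mean of Z by summation over the
    values.  By Jensen's inequality it inherits the uniform integrability of Z, and
    the mean passes to the limit by right-continuity ([optional_stopping]).

    From II to III, the limit inferior of |X| is |X_infty|, which is integrable
    because X_infty is X at the stopping time +oo. *)

(** * Integrable functions and uniform integrability *)

Section integrable_functions.
Context (d : measure_display) (T : measurableType d) (R : realType).
Variable P : probability T R.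
Implicit Types (f g h : T -> R) (A : set T).
Local Notation L1 f := (P.-integrable setT (EFin \o f)).

Lemma L1_measurable f : L1 f -> measurable_fun setT f.
Proof. by move=> /measurable_int/measurable_EFinP. Qed.

Lemma L1S A f : measurable A -> L1 f -> P.-integrable A (EFin \o f).
Proof. by move=> mA; apply: integrableS => //; exact: measurableT. Qed.

Lemma L1_le f g : measurable_fun setT f -> L1 g ->
  (forall w, `|f w| <= g w) -> L1 f.
Proof.
move=> mf ig fg; apply: (le_integrable _ _ _ ig) => //; first exact/measurable_EFinP.
by move=> w _; rewrite /= lee_fin (le_trans (fg w)) ?ler_norm.
Qed.

Lemma L1_ae (f g : T -> R) : measurable_fun setT f -> L1 g ->
  {ae P, forall w, f w = g w} -> L1 f.
Proof.
move=> mf /[dup] ig /integrableP[mg gfin] fg.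
apply/integrableP; split; first exact/measurable_EFinP.
rewrite (_ : (\int[P]_w _)%E = (\int[P]_w `|(EFin \o g) w|)%E)//.
apply: ae_eq_integral => //.
- by apply: measurableT_comp => //; exact/measurable_EFinP.
- exact: measurableT_comp.
- by apply: filterS fg => w fgw _ /=; rewrite fgw.
Qed.

Lemma L1_cst (c : R) : L1 (fun=> c).
Proof. exact: finite_measure_integrable_cst. Qed.

Lemma L1D f g : L1 f -> L1 g -> L1 (fun w => f w + g w).
Proof. exact: integrableD. Qed.

Lemma L1B f g : L1 f -> L1 g -> L1 (fun w => f w - g w).
Proof. exact: integrableB. Qed.

Lemma L1_norm f : L1 f -> L1 (fun w => `|f w|).
Proof. exact: integrable_norm. Qed.

Lemma L1_restrict f B : measurable B -> L1 f -> L1 (f \_ B).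
Proof.
move=> mB if_; apply: L1_le (L1_norm if_) _ => [|w].
  by apply/(measurable_restrictT _ mB)/measurable_funTS; exact: L1_measurable if_.
by rewrite /patch; case: ifPn => _; rewrite ?normr0// ?ler_norm.
Qed.

Lemma L1_max0 f : L1 f -> L1 (fun w => Num.max (f w) 0).
Proof.
move=> if_; apply: (L1_le _ (L1_norm if_)) => [|w].
  by apply: measurable_maxr => //; exact: L1_measurable.
by rewrite ger0_norm ?le_max ?lexx ?orbT// ge_max normr_ge0 ler_norm.
Qed.

Lemma L1_sum n (f : nat -> T -> R) : (forall i, L1 (f i)) ->
  L1 (fun w => \sum_(i < n) f i w).
Proof.
move=> if_; elim: n => [|n IHn].
  by apply: eq_integrable (L1_cst 0) => // w _ /=; rewrite big_ord0.
apply: eq_integrable (L1D IHn (if_ n)) => // w _ /=.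
by rewrite big_ord_recr.
Qed.

Lemma Rintegral_sum n (f : nat -> T -> R) : (forall i, L1 (f i)) ->
  \int[P]_w (\sum_(i < n) f i w) = \sum_(i < n) \int[P]_w f i w.
Proof.
move=> if_; elim: n => [|n IHn].
  rewrite big_ord0 -[RHS](mul0r (fine (P setT))) -Rintegral_cst//.
  by apply: eq_Rintegral => w _; rewrite big_ord0.
rewrite big_ord_recr /= -IHn -RintegralD//; last exact: L1_sum.
by apply: eq_Rintegral => w _; rewrite big_ord_recr.
Qed.

Lemma Rintegral_fineK A f : measurable A -> L1 f ->
  (\int[P]_(w in A) (f w)%:E = (\int[P]_(w in A) f w)%:E)%E.
Proof.
by move=> mA if_; rewrite fineK//; apply: integrable_fin_num => //; exact: L1S.
Qed.

Lemma Rintegral_setC A f : measurable A -> L1 f ->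
  \int[P]_w f w = \int[P]_(w in A) f w + \int[P]_(w in ~` A) f w.
Proof.
move=> mA if_; rewrite -(setUv A) Rintegral_setU//.
- exact: measurableC.
- by rewrite setUv.
- by apply/disj_setPS; rewrite setICr.
Qed.

Lemma mean_cst (c : R) : \int[P]_w c = c.
Proof.
rewrite Rintegral_cst//.
have -> : fine (P setT) = 1 by rewrite probability_setT.
by rewrite mulr1.
Qed.

Lemma le_RintegralS A f : measurable A -> L1 f -> (forall w, 0 <= f w) ->
  \int[P]_(w in A) f w <= \int[P]_w f w.
Proof. by move=> mA if_ f0; rewrite (Rintegral_setC mA)// lerDl Rintegral_ge0. Qed.

Lemma sum_Rintegral_le (D : nat -> set T) f n : trivIset setT D ->
  (forall i, measurable (D i)) -> L1 f -> (forall w, 0 <= f w) ->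
  \sum_(i < n) \int[P]_(w in D i) f w <= \int[P]_w f w.
Proof.
move=> tD mD if_ f0; rewrite -lee_fin -Rintegral_fineK//.
have mf : measurable_fun setT (EFin \o f) by case/integrableP: if_.
apply: (@le_trans _ _ (\int[P]_(w in \bigcup_i D i) (f w)%:E)%E); last first.
  by apply: ge0_subset_integral => //; [exact: bigcupT_measurable|move=> w _; rewrite lee_fin].
rewrite ge0_integral_bigcup//; last 2 first.
- exact: measurable_funTS.
- by move=> w _; rewrite lee_fin.
rewrite -sumEFin; under eq_bigr do rewrite -Rintegral_fineK//.
rewrite -(big_mkord xpredT (fun i => \int[P]_(w in D i) (f w)%:E)%E).
by apply: nneseries_lim_ge => i _ _; apply: integral_ge0 => w _; rewrite lee_fin.
Qed.

Lemma ae_eq_Rintegral A f g : measurable A ->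
  measurable_fun setT f -> measurable_fun setT g ->
  {ae P, forall w, A w -> f w = g w} ->
  \int[P]_(w in A) f w = \int[P]_(w in A) g w.
Proof.
move=> mA mf mg fg; congr fine; apply: ae_eq_integral => //.
- by apply/measurable_EFinP; apply: measurable_funTS.
- by apply/measurable_EFinP; apply: measurable_funTS.
by apply: filterS fg => w fg /fg ->.
Qed.

Lemma probability_fineK A : measurable A -> P A = (fine (P A))%:E.
Proof. by move=> mA; rewrite fineK//; exact: fin_num_measure. Qed.

(** The excess over the level K controls uniform integrability as well as the tail
    beyond K does, and it is convex, so that it decreases under conditional means. *)
Definition excess (K x : R) : R := Num.max (`|x| - K) 0.

Lemma excess_ge0 K x : 0 <= excess K x.
Proof. by rewrite le_max lexx orbT. Qed.

Lemma norm_le_excess K x : `|x| <= K + excess K x.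
Proof. by rewrite -lerBlDl le_max lexx. Qed.

Lemma measurable_excess K f : measurable_fun setT f ->
  measurable_fun setT (fun w => excess K (f w)).
Proof.
move=> mf; apply: measurable_maxr => //; apply: measurable_funB => //.
exact: measurableT_comp.
Qed.

Lemma L1_excess K f : L1 f -> L1 (fun w => excess K (f w)).
Proof. by move=> if_; apply/L1_max0/L1B; [exact: L1_norm|exact: L1_cst]. Qed.

Definition clip (K x : R) : R := Num.max (- K) (Num.min K x).

Lemma clip_excess K x : 0 <= K -> `|x - clip K x| = excess K x.
Proof.
move=> K0; rewrite /clip /excess.
have [Kx|xK] := leP K x.
  rewrite max_r; last by lra.
  by rewrite !ger0_norm ?subr_ge0 ?(le_trans K0)// max_l// subr_ge0.
have [Kx|xK'] := leP (- K) x.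
  by rewrite subrr normr0 max_r// subr_le0 ler_norml Kx ltW.
rewrite !ler0_norm; [|lra|lra]; rewrite max_l; lra.
Qed.

Lemma norm_clip K x : 0 <= K -> `|clip K x| <= K.
Proof. by move=> K0; rewrite ler_norml /clip le_max lexx/= ge_max ge_min lexx; lra. Qed.

Lemma measurable_clip K f : measurable_fun setT f ->
  measurable_fun setT (fun w => clip K (f w)).
Proof. by move=> mf; apply: measurable_maxr => //; exact: measurable_minr. Qed.

Lemma cvg_lipschitz1 (g : R -> R) (u : nat -> R) l :
  (forall x y, `|g x - g y| <= `|x - y|) ->
  u n @[n --> \oo] --> l -> g (u n) @[n --> \oo] --> g l.
Proof.
move=> lip /cvgrPdist_le ul; apply/cvgrPdist_le => e e0.
by apply: filterS (ul e e0) => n; apply: le_trans; exact: lip.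
Qed.

Lemma lipschitz_max (K x y : R) : `|Num.max x K - Num.max y K| <= `|x - y|.
Proof.
have [xK|Kx] := leP x K; have [yK|Ky] := leP y K;
  rewrite ler_norml; have := ler_norm (x - y); have := ler_norm (y - x);
  rewrite (distrC y x); lra.
Qed.

Lemma cvg_clip K (u : nat -> R) l : u n @[n --> \oo] --> l ->
  clip K (u n) @[n --> \oo] --> clip K l.
Proof.
apply: cvg_lipschitz1 => x y; rewrite /clip !(maxC (- K)).
apply: le_trans (lipschitz_max _ _ _) _.
rewrite -[Num.min K x]opprK -[Num.min K y]opprK !oppr_min !(maxC (- K)).
by rewrite opprK addrC; apply: le_trans (lipschitz_max _ _ _) _; rewrite opprK addrC.
Qed.

Lemma cvg_excess K (u : nat -> R) l : u n @[n --> \oo] --> l ->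
  excess K (u n) @[n --> \oo] --> excess K l.
Proof.
apply: cvg_lipschitz1 => x y; apply: le_trans (lipschitz_max _ _ _) _.
by rewrite opprB addrA subrK; exact: ler_dist_dist.
Qed.

Lemma excess_fatou K (e : R) (f : nat -> T -> R) h :
  (forall n, measurable_fun setT (f n)) -> measurable_fun setT h ->
  {ae P, forall w, f n w @[n --> \oo] --> h w} ->
  (forall n, \int[P]_w (excess K (f n w))%:E <= e%:E)%E ->
  (\int[P]_w (excess K (h w))%:E <= e%:E)%E.
Proof.
move=> mf mh fh fe.
have mef n : measurable_fun setT (fun w => (excess K (f n w))%:E).
  by apply/measurable_EFinP; exact: measurable_excess.
have meh : measurable_fun setT (fun w => (excess K (h w))%:E).
  by apply/measurable_EFinP; exact: measurable_excess.
have -> : (\int[P]_w (excess K (h w))%:E =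
           \int[P]_w limn_einf (fun n => (excess K (f n w))%:E))%E.
  apply: ae_eq_integral => //.
    apply: measurableT_comp => //; apply: measurable_fun_limn_esup => n.
    exact: measurableT_comp.
  apply: filterS fh => w fh _.
  suff /cvg_limn_einf_sup[->] : (excess K (f n w))%:E @[n --> \oo] --> (excess K (h w))%:E by [].
  by apply: cvg_EFin; [exact: nearW|exact: cvg_excess].
apply: le_trans (fatou P measurableT mef _) _.
  by move=> n w _; rewrite lee_fin excess_ge0.
rewrite limn_einf_lim; apply: lime_le; first exact: is_cvg_einfs.
apply: nearW => n; apply: le_trans (fe n).
by apply: ereal_inf_lbound; exists n => /=.
Qed.

(** A form of Vitali's convergence theorem.  Clipping at a level with small excess
    changes the means little and makes the functions bounded, so that dominated
    convergence applies to the clipped functions. *)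
Lemma ui_ae_limit (f : nat -> T -> R) h :
  (forall n, measurable_fun setT (f n)) -> measurable_fun setT h ->
  {ae P, forall w, f n w @[n --> \oo] --> h w} ->
  (forall e, 0 < e -> exists2 K, 0 <= K &
     forall n, (\int[P]_w (excess K (f n w))%:E <= e%:E)%E) ->
  L1 h /\ forall c, (forall n, \int[P]_w f n w = c) -> \int[P]_w h w = c.
Proof.
move=> mf mh fh ui.
have L1_of_excess g K e : measurable_fun setT g ->
    (\int[P]_w (excess K (g w))%:E <= e%:E)%E -> L1 g.
  move=> mg ge.
  have ig : L1 (fun w => excess K (g w)).
    apply/integrableP; split; first exact/measurable_EFinP/measurable_excess.
    apply: le_lt_trans (ltry e); apply: le_trans ge.
    rewrite le_eqVlt; apply/orP; left; apply/eqP/eq_integral => w _ /=.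
    by rewrite ger0_norm// excess_ge0.
  apply: (L1_le mg (L1D (L1_cst K) ig)) => w; exact: norm_le_excess.
have if_ n : L1 (f n) by have [K _ /(_ n)] := ui _ ltr01; exact: L1_of_excess.
have ih : L1 h.
  have [K _ uK] := ui _ ltr01.
  exact: L1_of_excess mh (excess_fatou mf mh fh uK).
split => // c fc; apply/eqP; rewrite -subr_eq0 -normr_le0.
apply/ler_addgt0Pl => e e0; rewrite addr0.
have e3 : 0 < e / 3 by rewrite divr_gt0.
have [K K0 uK] := ui _ e3.
have near_clip g : L1 g -> (\int[P]_w (excess K (g w))%:E <= (e / 3)%:E)%E ->
    `|\int[P]_w g w - \int[P]_w clip K (g w)| <= e / 3.
  move=> ig ge.
  have ic : L1 (fun w => clip K (g w)).
    apply: L1_le (L1_cst K) _; last by move=> w; exact: norm_clip.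
    exact/measurable_clip/L1_measurable.
  rewrite -RintegralB//; apply: le_trans (le_normr_Rintegral _ _) _ => //.
    exact: L1B.
  rewrite -lee_fin -Rintegral_fineK//; last exact/L1_norm/L1B.
  by under eq_integral do rewrite clip_excess//.
have mcf n := (measurable_EFinP _ _).2 (measurable_clip K (mf n)).
have mch := (measurable_EFinP _ _).2 (measurable_clip K mh).
have [||_ _] := dominated_convergence measurableT mcf mch _ (L1_cst K) _.
- by apply: filterS fh => w fh _ /=; apply: cvg_EFin; [exact: nearW|exact: cvg_clip].
- by apply/aeW => w n _ /=; rewrite lee_fin norm_clip.
rewrite /= Rintegral_fineK//; last first.
  by apply: L1_le (L1_cst K) _; [exact: measurable_clip|move=> w; exact: norm_clip].
move=> /fine_cvg cc.
have {cc} : \int[P]_w clip K (f n w) @[n --> \oo] --> \int[P]_w clip K (h w) by [].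
move=> /cvgrPdist_le/(_ _ e3)[N _ /(_ _ (leqnn N)) /= hN].
have := near_clip _ ih (excess_fatou mf mh fh uK).
have := near_clip _ (if_ N) (uK N).
move: hN; rewrite fc !ler_norml; lra.
Qed.

Lemma excess_mean_small f (e : R) : L1 f -> 0 < e ->
  exists2 K, 0 <= K & \int[P]_w excess K (f w) <= e.
Proof.
move=> if_ e0.
have me n : measurable_fun setT (fun w => (excess n%:R (f w))%:E).
  by apply/measurable_EFinP/measurable_excess; exact: L1_measurable.
have [||_ _] := @dominated_convergence _ _ _ P _ measurableT _ (cst 0%E) _
    me (measurable_cst _) _ (L1_norm if_) _.
- apply/aeW => w _; apply: cvg_near_cst; near=> n.
  rewrite /excess max_r// subr_le0; apply: ltW; near: n.
  exact: nbhs_infty_gtr.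
- apply/aeW => w n _; rewrite lee_fin ger0_norm ?excess_ge0//.
  by rewrite /excess ge_max normr_ge0 andbT lerBlDr lerDl.
rewrite integral_cst//= mul0e => /fine_cvg/cvgrPdist_le/(_ _ e0)[n _ /(_ _ (leqnn n))].
rewrite /= sub0r normrN => /(le_trans (ler_norm _)) ne.
by exists n%:R.
Unshelve. all: end_near.
Qed.

(** The limit need not be measurable, as it is arbitrary on the null set where
    convergence fails; resetting it on a measurable null set makes it so. *)
Lemma ae_limit_version (f : nat -> T -> R) h :
  (forall n, measurable_fun setT (f n)) ->
  {ae P, forall w, f n w @[n --> \oo] --> h w} ->
  exists2 h', measurable_fun setT h' & {ae P, forall w, h w = h' w}.
Proof.
move=> mf [A [mA PA0 sub]]; exists (h \_ (~` A)).
  apply: (measurable_fun_cvg (h := fun n => f n \_ (~` A))) => [n|w _].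
    apply/(measurable_restrictT _ (measurableC mA)).
    exact: measurable_funTS.
  rewrite /patch; case: ifPn => [|_]; last exact: cvg_cst.
  rewrite inE => nAw; apply: contrapT => nh; apply: nAw; exact: sub.
exists A; split => // w /= nh; apply: contrapT => nAw; apply: nh.
by rewrite /patch mem_set.
Qed.

End integrable_functions.

(** * Conditional means given a sub-sigma-algebra *)

Section sub_sigma_algebra.
Context (T : Type) (G : set (set T)) (sG : sigma_algebra setT G).
Implicit Types A B : set T.

Lemma subsigmaC A : G A -> G (~` A).
Proof. by rewrite -setTD; case: sG => _ /(_ A). Qed.

Lemma subsigma_bigcup (A : nat -> set T) : (forall n, G (A n)) -> G (\bigcup_n A n).
Proof. by case: sG => _ _; exact. Qed.

Lemma subsigma0 : G set0. Proof. by case: sG. Qed.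

Lemma subsigmaT : G setT. Proof. by rewrite -setC0; exact/subsigmaC/subsigma0. Qed.

Lemma subsigmaU A B : G A -> G B -> G (A `|` B).
Proof.
move=> GA GB; rewrite -bigcup2E; apply: subsigma_bigcup => -[|[|n]] //=.
exact: subsigma0.
Qed.

Lemma subsigmaI A B : G A -> G B -> G (A `&` B).
Proof.
by move=> GA GB; rewrite -[A `&` B]setCK setCI; apply/subsigmaC/subsigmaU; exact: subsigmaC.
Qed.

Lemma subsigmaD A B : G A -> G B -> G (A `\` B).
Proof. by move=> GA GB; rewrite setDE; apply: subsigmaI => //; exact: subsigmaC. Qed.

End sub_sigma_algebra.

Section conditional_mean.
Context (d : measure_display) (T : measurableType d) (R : realType).
Variable P : probability T R.
Variables (G : set (set T)) (sG : sigma_algebra setT G) (Gm : G `<=` measurable).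
Implicit Types (f g h U V : T -> R) (A : set T).
Local Notation L1 f := (P.-integrable setT (EFin \o f)).
Local Notation Gmeasurable f := (measurable_fun setT (f : g_sigma_algebraType G -> R)).

Lemma subsigma_preimage f (B : set R) : Gmeasurable f -> measurable B -> G (f @^-1` B).
Proof.
move=> mf mB; have := mf measurableT B mB.
by rewrite setTI /measurable /= sigma_algebra_id.
Qed.

Lemma subsigma_measurable_fun f : Gmeasurable f -> measurable_fun setT f.
Proof. by move=> mf _ B mB; rewrite setTI; apply/Gm/subsigma_preimage. Qed.

Lemma subsigma_gt f K : Gmeasurable f -> G [set w | K < f w].
Proof.
move=> mf; have -> : [set w | K < f w] = f @^-1` `]K, +oo[%classic.
  by apply/seteqP; split => w /=; rewrite in_itv/= andbT.
exact: subsigma_preimage.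
Qed.

Lemma subsigma_ltNr f K : Gmeasurable f -> G [set w | K < - f w].
Proof.
move=> mf; have -> : [set w | K < - f w] = f @^-1` `]-oo, (- K)[%classic.
  by apply/seteqP; split => w /=; rewrite in_itv/= ltrNr.
exact: subsigma_preimage.
Qed.

(** U is a version of the conditional expectation of V given G, with the defining
    identity stated for real integrals. *)
Definition cond_mean V U : Prop :=
  [/\ Gmeasurable U, L1 U, L1 V &
      forall A, G A -> \int[P]_(w in A) U w = \int[P]_(w in A) V w].

Lemma cond_meanP V U : L1 V -> cond_mean V U <-> is_cond_expectation P G V U.
Proof.
move=> iV; split=> [[mU iU _ UV]|[mU iU UV]]; split => // A GA.
  by rewrite !Rintegral_fineK ?UV//; exact: Gm.
by rewrite /Rintegral UV.
Qed.

(** Only indicators are taken out of the conditional mean: this is enough for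
    convex functions that are piecewise linear. *)
Lemma cond_mean_restrict V U A B : cond_mean V U -> G A -> G B ->
  \int[P]_(w in A) ((V \- U) \_ B) w = 0.
Proof.
move=> [mU iU iV UV] GA GB.
have GAB : G (A `&` B) by exact: subsigmaI.
rewrite -Rintegral_mkcondr RintegralB ?UV ?subrr//; [exact: Gm|..].
  by apply: L1S => //; exact: Gm.
by apply: L1S => //; exact: Gm.
Qed.

(** Jensen's inequality for the excess, a convex function with slopes 1, -1 and 0
    on three intervals: the term that is linear in V - U has mean zero on the
    events where U lies in one of these intervals. *)
Lemma cond_mean_excess V U (K : R) A : cond_mean V U -> 0 <= K -> G A ->
  \int[P]_(w in A) excess K (U w) <= \int[P]_(w in A) excess K (V w).
Proof.
move=> UV K0 GA; have [mU iU iV _] := UV.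
set B1 := [set w | K < U w]; set B2 := [set w | K < - U w].
have GB1 : G B1 by exact: subsigma_gt.
have GB2 : G B2 by exact: subsigma_ltNr.
have iD B : G B -> L1 ((V \- U) \_ B).
  by move=> GB; apply: L1_restrict; [exact: Gm|exact: L1B].
have := cond_mean_restrict UV GA GB1; have := cond_mean_restrict UV GA GB2 => E2 E1.
have mA := Gm GA.
rewrite -[leRHS]subr0 -E1 -RintegralB//; [|exact/L1S/L1_excess|exact/L1S/iD].
rewrite -[leRHS]addr0 -E2 -RintegralD//; last first.
- exact/L1S/iD.
- by apply: L1S => //; apply: L1B; [exact: L1_excess|exact: iD].
apply: le_Rintegral => //.
- exact/L1S/L1_excess.
- by apply: L1S => //; apply: L1D; [apply: L1B; [exact: L1_excess|exact: iD]|exact: iD].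
move=> w _; rewrite /patch /excess (_ : point = 0 :> R)//=.
have maxl (z : R) : z <= Num.max z 0 by rewrite le_max lexx.
have max0 (z : R) : 0 <= Num.max z 0 by rewrite le_max lexx orbT.
have := maxl (`|V w| - K); have := max0 (`|V w| - K).
have := ler_norm (V w); have := ler_norm (- V w); rewrite normrN => ? ? ? ?.
rewrite (_ : (w \in B1) = (K < U w)); last by apply/idP/idP; rewrite inE.
rewrite (_ : (w \in B2) = (K < - U w)); last by apply/idP/idP; rewrite inE.
have [K1|K1] := ltP K (U w); have [K2|K2] := ltP K (- U w).
- lra.
- rewrite (@ger0_norm _ (U w)); last by lra.
  by rewrite [X in X <= _]max_l; lra.
- rewrite (@ler0_norm _ (U w)); last by lra.
  by rewrite [X in X <= _]max_l; lra.
- rewrite [X in X <= _]max_r; first by lra.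
  by rewrite subr_le0 ler_norml; lra.
Qed.

Lemma cond_mean_norm V U A : cond_mean V U -> G A ->
  \int[P]_(w in A) `|U w| <= \int[P]_(w in A) `|V w|.
Proof.
move=> UV GA; have := cond_mean_excess UV (lexx 0) GA.
have E x : excess 0 x = `|x| :> R by rewrite /excess subr0 max_l.
by under eq_Rintegral do rewrite E; under [leRHS]eq_Rintegral do rewrite E.
Qed.

(** The gap between the convex function (. - a)^+ and its tangent at x, measured
    at y: it is the distance from a to y if a separates x from y, and 0 otherwise. *)
Definition tangent_gap (a x y : R) : R :=
  Num.max (y - a) 0 - Num.max (x - a) 0 - (if a < x then y - x else 0).

Lemma tangent_gap_le a x y : x <= a -> tangent_gap a x y = Num.max (y - a) 0.
Proof.
by move=> xa; rewrite /tangent_gap ltNge xa/= (@max_r _ _ (x - a)) ?subr_le0// !subr0.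
Qed.

Lemma tangent_gap_gt a x y : a < x -> tangent_gap a x y = Num.max (a - y) 0.
Proof.
move=> ax; rewrite /tangent_gap ax (@max_l _ _ (x - a)); last by lra.
by have [ya|ay] := leP (y - a) 0; [rewrite max_l|rewrite max_r]; lra.
Qed.

Lemma tangent_gap_ge0 a x y : 0 <= tangent_gap a x y.
Proof.
by have [/tangent_gap_le->|/tangent_gap_gt->] := leP x a; rewrite le_max lexx orbT.
Qed.

Lemma tangent_gap_mean V U a : cond_mean V U ->
  \int[P]_w tangent_gap a (U w) (V w) =
  \int[P]_w Num.max (V w - a) 0 - \int[P]_w Num.max (U w - a) 0.
Proof.
move=> UV; have [mU iU iV _] := UV.
have iM f : L1 f -> L1 (fun w => Num.max (f w - a) 0).
  by move=> if_; apply/L1_max0/L1B => //; exact: L1_cst.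
have GB : G [set w | a < U w] by exact: subsigma_gt.
have E := cond_mean_restrict UV (subsigmaT sG) GB.
rewrite -RintegralB//; [|exact: iM|exact: iM].
rewrite -[RHS]subr0 -[X in _ = _ - X]E -RintegralB//; first last.
- by apply: L1_restrict; [exact: Gm|exact: L1B].
- by apply: L1B; exact: iM.
apply: eq_Rintegral => w _; rewrite /tangent_gap /patch.
by rewrite (_ : (w \in _) = (a < U w))//; apply/idP/idP; rewrite inE.
Qed.

(** If x lies in [-K, K], the first grid point a met from x in the direction of y is
    within e of x, and the gap at a is at least what remains of the way to y.
    Otherwise a = K or a = - K is as good, up to the excesses. *)
Lemma dist_le_tangent_gaps (K e : R) N (x y : R) :
  0 <= K -> 0 < e -> N%:R * e = K + K ->
  `|y - x| <= e + \sum_(i < N.+1) tangent_gap (i%:R * e - K) x y +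
             excess K x + excess K y.
Proof.
move=> K0 e0 NK.
have sum_ge i : (i <= N)%N ->
    tangent_gap (i%:R * e - K) x y <= \sum_(j < N.+1) tangent_gap (j%:R * e - K) x y.
  rewrite -ltnS => iN; rewrite (bigD1 (Ordinal iN))//= lerDl.
  by apply: sumr_ge0 => j _; exact: tangent_gap_ge0.
have max_ge (z : R) : z <= Num.max z 0 by rewrite le_max lexx.
have max_ge0 (z : R) : 0 <= Num.max z 0 by rewrite le_max lexx orbT.
have ex1 : `|x| - K <= excess K x := max_ge _.
have ey1 : `|y| - K <= excess K y := max_ge _.
have ex0 := excess_ge0 K x; have ey0 := excess_ge0 K y.
have nx1 := ler_norm x; have nx2 := ler_norm (- x); rewrite normrN in nx2.
have ny1 := ler_norm y; have ny2 := ler_norm (- y); rewrite normrN in ny2.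
have [Kx|xK] := ltP K x.
  have /tangent_gap_gt gN : N%:R * e - K < x by lra.
  have := sum_ge _ (leqnn N); rewrite gN.
  have := max_ge (N%:R * e - K - y); have := max_ge0 (N%:R * e - K - y).
  rewrite ler_norml; lra.
have [xNK|NKx] := leP x (- K).
  have := sum_ge _ (leq0n N); rewrite mul0r sub0r tangent_gap_le//.
  have := max_ge (y - - K); have := max_ge0 (y - - K).
  rewrite ler_norml; lra.
have exi : exists i, x <= i%:R * e - K by exists N; lra.
have [[|i]] := ex_minnP exi; first by rewrite mul0r; lra.
rewrite -natr1 => xi imin.
have iN : (i.+1 <= N)%N by apply: imin; lra.
have ix : i%:R * e - K < x.
  by rewrite ltNge; apply/negP => /imin; rewrite ltnn.
have [yx|xy] := leP y x.
  have := sum_ge _ (ltnW iN); rewrite tangent_gap_gt//.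
  have := max_ge (i%:R * e - K - y).
  rewrite ler_norml; lra.
have := sum_ge _ iN; rewrite -natr1 tangent_gap_le//.
have := max_ge (y - ((i%:R + 1) * e - K)).
rewrite ler_norml; lra.
Qed.

(** The tangent term of a gap has mean zero, so that the mean of the gap at a is
    the increase of the mean of (. - a)^+ from U to V. *)
Lemma cond_mean_dist V U (K e : R) N : cond_mean V U ->
  0 <= K -> 0 < e -> N%:R * e = K + K ->
  \int[P]_w `|V w - U w| <=
  e + (\sum_(i < N.+1) \int[P]_w Num.max (V w - (i%:R * e - K)) 0 -
       \sum_(i < N.+1) \int[P]_w Num.max (U w - (i%:R * e - K)) 0) +
  \int[P]_w excess K (U w) + \int[P]_w excess K (V w).
Proof.
move=> UV K0 e0 NK; have [mU iU iV _] := UV.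
have ig i : L1 (fun w => tangent_gap (i%:R * e - K) (U w) (V w)).
  have iM f a : L1 f -> L1 (fun w => Num.max (f w - a) 0).
    by move=> if_; apply/L1_max0/L1B => //; exact: L1_cst.
  have iD : L1 ((V \- U) \_ [set w | i%:R * e - K < U w]).
    by apply: L1_restrict; [exact/Gm/subsigma_gt|exact: L1B].
  apply: eq_integrable (L1B (L1B (iM _ _ iV) (iM _ _ iU)) iD) => // w _ /=.
  rewrite /tangent_gap /patch.
  by rewrite (_ : (w \in _) = (i%:R * e - K < U w))//; apply/idP/idP; rewrite inE.
have is_ := L1_sum N.+1 ig.
have ie := L1D (L1_cst P e) is_.
have ieU := L1D ie (L1_excess K iU).
apply: le_trans (le_Rintegral (f2 := fun w => e +
    \sum_(i < N.+1) tangent_gap (i%:R * e - K) (U w) (V w) +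
    excess K (U w) + excess K (V w)) measurableT _ _ _) _.
- by apply: L1_norm; exact: L1B.
- by apply: L1D => //; exact: L1_excess.
- by move=> w _; exact: dist_le_tangent_gaps.
rewrite RintegralD//; last exact: L1_excess.
rewrite RintegralD//; last exact: L1_excess.
rewrite RintegralD//; last exact: L1_cst.
rewrite mean_cst -sumrB (Rintegral_sum _ ig).
by under eq_bigr do rewrite tangent_gap_mean//.
Qed.

End conditional_mean.

(** * Dyadic times *)

Section dyadic.
Context (R : realType).
Implicit Types (a t : R).

Definition dyadic a (p i : nat) : R := a + i%:R / 2 ^+ p.

Lemma dyadic_ge a p i : a <= dyadic a p i.
Proof. by rewrite /dyadic lerDl divr_ge0// exprn_ge0. Qed.

Lemma le_dyadic a p i j : (i <= j)%N -> dyadic a p i <= dyadic a p j.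
Proof.
by move=> ij; rewrite /dyadic lerD2l ler_pM2r ?ler_nat// invr_gt0 exprn_gt0.
Qed.

Lemma dyadicS a p i : dyadic a p i = dyadic a p.+1 (2 * i).
Proof.
rewrite /dyadic natrM exprS; congr (_ + _).
have : (2 : R) ^+ p != 0 by rewrite gt_eqF// exprn_gt0.
by move=> ?; rewrite invfM mulrACA divff// mul1r.
Qed.

Lemma dyadic_refine a p q i : (p <= q)%N -> dyadic a p i = dyadic a q (2 ^ (q - p) * i).
Proof.
move=> pq; rewrite -{1}(subnKC pq); elim: (q - p)%N => [|n IHn].
  by rewrite addn0 expn0 mul1n.
by rewrite addnS expnS -mulnA -dyadicS.
Qed.

(** With ranks up to 4 ^ p, the grid of mesh 2 ^- p is finite, has length 2 ^ p, and
    thus still contains points just after t once p is large. *)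
Lemma dyadic_right_approx (x : R -> R) a t (A : set R) : a <= t ->
  x s @[s --> t^'+] --> x t -> open A -> A (x t) ->
  exists p i, (i <= 4 ^ p)%N /\ A (x (dyadic a p i)).
Proof.
move=> at_ xt oA Axt.
have : \forall s \near t^'+, A (x s) by apply: xt; exact: open_nbhs_nbhs.
move=> /nbhs_ballP[e /= e0 he].
(* 2 ^ p exceeds e^-1, for the mesh, and t - a + 1, for the bound on the rank. *)
set p := Num.truncn (e^-1 + (t - a) + 1); set i := (Num.truncn ((t - a) * 2 ^+ p)).+1.
have ta0 : 0 <= t - a by rewrite subr_ge0.
have p0 : (0 : R) < 2 ^+ p by rewrite exprn_gt0.
have ei0 : 0 < e^-1 by rewrite invr_gt0.
have pB : e^-1 + (t - a) + 1 <= 2 ^+ p.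
  have c0 : 0 <= e^-1 + (t - a) + 1 by lra.
  have /andP[_ /ltW/le_trans] := Num.Theory.truncn_itv c0; apply.
  by rewrite -natrX ler_nat ltn_expl.
have /andP[i1 i2] : i.-1%:R <= (t - a) * 2 ^+ p < i%:R.
  by apply: Num.Theory.truncn_itv; rewrite mulr_ge0// ltW.
have iS : i%:R = i.-1%:R + 1 :> R by rewrite natr1.
have pe : (2 ^+ p)^-1 < e.
  by rewrite -[ltRHS]invrK ltf_pV2 ?posrE//; lra.
exists p, i; split.
  rewrite -(ler_nat R) iS natrX.
  have -> : (4 : R) ^+ p = 2 ^+ p * 2 ^+ p by rewrite -exprMn; congr (_ ^+ _); lra.
  apply: (@le_trans _ _ ((2 ^+ p - 1) * 2 ^+ p + 1)); last by lra.
  rewrite lerD2r (le_trans i1)// ler_wpM2r ?ltW//; lra.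
have lti : t < dyadic a p i by rewrite /dyadic -ltrBlDl ltr_pdivlMr.
apply: he => //; rewrite /ball /= ltr0_norm ?subr_lt0// opprB.
apply: le_lt_trans pe; rewrite /dyadic iS mulrDl mul1r.
have : i.-1%:R / 2 ^+ p <= t - a by rewrite ler_pdivrMr.
lra.
Qed.

End dyadic.

(** * Adapted and uniformly integrable processes *)

Section processes.
Context (d : measure_display) (T : measurableType d) (R : realType).
Variables (P : probability T R) (F : R -> set (set T)) (hF : filtration F).
Implicit Types (X : R -> T -> R) (A : set T) (e K s t : R).
Local Notation L1 f := (P.-integrable setT (EFin \o f)).

Lemma filtration_sigma_algebra t : 0 <= t -> sigma_algebra setT (F t).
Proof. by case: hF => + _ => /(_ t) /[apply] -[]. Qed.

Lemma filtration_measurable t A : 0 <= t -> F t A -> measurable A.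
Proof. by case: hF => + _ => /(_ t) /[apply] -[_]; exact. Qed.

Lemma filtration_le s t A : 0 <= s -> s <= t -> F s A -> F t A.
Proof. by move=> s0 st; case: hF => _ /(_ s t s0 st); exact. Qed.

Lemma progressive_adapted X : progressive F X -> adapted F X.
Proof.
move=> pX t t0.
have Et : (fun p : R * g_sigma_algebraType (F t) => X p.1 p.2) \o pair t = X t by [].
rewrite -Et; apply: (measurable_comp _ _ (pX t t0)).
- apply: measurableX => //; exact: measurable_itv.
- by move=> _ [w _ <-]; split => //=; rewrite in_itv/= t0 lexx.
exact: pair1_measurable.
Qed.

Section integrable_martingale.
Variable X : R -> T -> R.
Hypothesis aX : adapted F X.

Lemma adapted_measurable t : 0 <= t -> measurable_fun setT (X t).
Proof.
move=> t0; apply: (subsigma_measurable_fun (filtration_sigma_algebra t0)) (aX t0).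
by move=> A; exact: filtration_measurable.
Qed.

Lemma adapted_mono s t : 0 <= s -> s <= t ->
  measurable_fun setT (X s : g_sigma_algebraType (F t) -> R).
Proof.
move=> s0 st _ B mB; rewrite setTI.
have := subsigma_preimage (filtration_sigma_algebra s0) (aX s0) mB.
move=> /(filtration_le s0 st) FB.
exact: sub_sigma_algebra.
Qed.

Definition tail_mean (c : R) : \bar R :=
  ereal_sup [set (\int[P]_(w in [set w | (c < `|X t w|)%R]) `|X t w|%:E)%E
            | t in [set t : R | 0 <= t]].

Lemma subsigma_tail (c t : R) : 0 <= t -> F t [set w | (c < `|X t w|)%R].
Proof.
move=> t0; have mX : measurable_fun setT
    ((fun w => `|X t w|) : g_sigma_algebraType (F t) -> R).
  by apply: measurableT_comp => //; exact: aX.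
exact: (subsigma_gt (filtration_sigma_algebra t0) c mX).
Qed.

Lemma ui_excess e : uniformly_integrable P X -> 0 < e -> exists2 K, 0 < K &
  forall t, 0 <= t -> (\int[P]_w (excess K (X t w))%:E <= e%:E)%E.
Proof.
move=> ui e0.
have : \forall c \near +oo%R, (tail_mean c < e%:E)%E.
  have oe : open [set x : \bar R | (x < e%:E)%E] by exact: open_ereal_lt_ereal.
  apply: (ui [set x : \bar R | (x < e%:E)%E]); apply: open_nbhs_nbhs.
  by split => //=; rewrite lte_fin.
move=> /pinfty_ex_gt0[K K0 /ltW tK]; exists K => // t t0.
apply: le_trans tK; apply: le_trans; last by apply: ereal_sup_ubound; exists t.
rewrite [leRHS]integral_mkcond; apply: ge0_le_integral => //.
- by move=> w _; rewrite lee_fin excess_ge0.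
- by apply/measurable_EFinP/measurable_excess; exact: adapted_measurable.
- have mt := filtration_measurable t0 (subsigma_tail K t0).
  apply/(measurable_restrictT _ mt)/measurable_funTS/measurable_EFinP.
  by apply: measurableT_comp => //; exact: adapted_measurable.
move=> w _; rewrite /patch /excess; case: ifPn.
  by rewrite inE /= lee_fin ge_max normr_ge0 andbT lerBlDr lerDl ltW.
by rewrite notin_setE /= => /negP; rewrite -leNgt lee_fin ge_max subr_le0 lexx andbT.
Qed.

(** Domination by the conditional means of a single integrable function gives
    uniform integrability: the events in question have small probability, by
    Markov's inequality, uniformly in t. *)
Lemma dominated_ui (D : T -> R) : L1 D -> (forall t, 0 <= t -> L1 (X t)) ->
  (forall t A, 0 <= t -> F t A ->
     \int[P]_(w in A) `|X t w| <= \int[P]_(w in A) `|D w| ) ->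
  uniformly_integrable P X.
Proof.
move=> iD iX XD.
have tail_ge0 c : (0 <= tail_mean c)%E.
  apply: (@le_trans _ _ (\int[P]_(w in [set w | (c < `|X 0 w|)%R]) `|X 0 w|%:E)%E).
    exact: integral_ge0.
  by apply: ereal_sup_ubound; exists 0 => /=.
suff tail_le e : 0 < e -> \forall c \near +oo%R, (tail_mean c <= e%:E)%E.
  change (tail_mean c @[c --> +oo%R] --> 0%E).
  apply/fine_cvgP; split.
    apply: filterS (tail_le 1 ltr01) => c c1.
    by rewrite ge0_fin_numE//; apply: le_lt_trans c1 (ltry _).
  apply/cvgrPdist_le => e e0; apply: filterS (tail_le e e0) => c ce.
  rewrite /= sub0r normrN ger0_norm ?fine_ge0// -lee_fin fineK//.
  by rewrite ge0_fin_numE//; apply: le_lt_trans ce (ltry _).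
move=> e0.
have [M M0 Me] := excess_mean_small iD (divr_gt0 e0 (ltr0Sn R 1)).
set m := \int[P]_w `|D w|.
have m0 : 0 <= m by exact: Rintegral_ge0.
near=> c.
have c0 : 0 < c by near: c; apply: nbhs_pinfty_gt.
(* By Markov's inequality, the tail event then has probability at most
   e / (2 * M). *)
have cM : 2 * M * m / e <= c by near: c; apply: nbhs_pinfty_ge; exact: num_real.
apply: ge_ereal_sup => _ [t /= t0 <-].
have GA := subsigma_tail c t0; set A := [set w | _] in GA *.
have mA := filtration_measurable t0 GA.
rewrite Rintegral_fineK//; last exact/L1_norm/iX.
rewrite lee_fin; apply: le_trans (XD _ _ t0 GA) _.
have PA : c * fine (P A) <= m.
  apply: (@le_trans _ _ (\int[P]_(w in A) `|X t w|)).
    rewrite -Rintegral_cst//; apply: le_Rintegral => //.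
    - exact/L1S/L1_cst.
    - exact/L1S/L1_norm/iX.
    - by move=> w; rewrite /A /= => /ltW.
  apply: le_trans (XD _ _ t0 GA) _; apply: le_RintegralS => //.
  exact: L1_norm.
apply: (@le_trans _ _ (\int[P]_(w in A) (M + excess M (D w)))).
  apply: le_Rintegral => //; [exact/L1S/L1_norm| |].
    by apply: L1S => //; apply: L1D; [exact: L1_cst|exact: L1_excess].
  by move=> w _; exact: norm_le_excess.
rewrite RintegralD//; [|exact/L1S/L1_cst|exact/L1S/L1_excess].
rewrite Rintegral_cst//.
have := le_RintegralS mA (L1_excess M iD) (fun w => excess_ge0 M (D w)).
have : M * fine (P A) <= e / 2.
  rewrite -(ler_pM2l c0) mulrCA; apply: le_trans (ler_wpM2l M0 PA) _.
  by move: cM; rewrite ler_pdivrMr//; lra.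
lra.
Unshelve. all: end_near.
Qed.

End integrable_martingale.
End processes.

(** * Convergence of uniformly integrable martingales *)

Section uniformly_integrable_martingale.
Context (d : measure_display) (T : measurableType d) (R : realType).
Variables (P : probability T R) (F : R -> set (set T)) (hF : filtration F).
Variables (X : R -> T -> R) (mX : martingale P F X).
Implicit Types (A : set T) (e K s t : R).
Local Notation L1 f := (P.-integrable setT (EFin \o f)).

Lemma martingale_L1 t : 0 <= t -> L1 (X t).
Proof. by case: mX => _ + _; exact. Qed.

Lemma martingale_cond_mean s t : 0 <= s -> s <= t -> cond_mean P (F s) (X t) (X s).
Proof.
move=> s0 st; apply/cond_meanP; last by case: mX => _ _; exact.
  by move=> A; exact: filtration_measurable.
exact/martingale_L1/(le_trans s0).
Qed.

Lemma cond_mean_sub (G : set (set T)) (V U W : T -> R) :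
  G `<=` measurable -> sigma_algebra setT G ->
  cond_mean P G V U -> measurable_fun setT (W : g_sigma_algebraType G -> R) -> L1 W ->
  cond_mean P G (fun w => V w - W w) (fun w => U w - W w).
Proof.
move=> Gm sG [mU iU iV UV] mW iW; split.
- exact: measurable_funB.
- exact: L1B.
- exact: L1B.
move=> A GA; have mA := Gm _ GA.
by rewrite RintegralB ?RintegralB ?UV//; exact: L1S.
Qed.

(** The functional Phi t = \sum_a E (X t - a)^+ over a finite grid of levels a is
    bounded, so that it hardly increases after a time s where it is almost
    maximal.  As its increase controls the distance in L1 from X s to X t, the
    martingale is Cauchy in L1. *)
Lemma martingale_L1_cauchy e : uniformly_integrable P X -> 0 < e ->
  exists2 s, 0 <= s & forall t, s <= t -> \int[P]_w `|X t w - X s w| <= e.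
Proof.
move=> ui e0; have [aX _ _] := mX.
have e4 : 0 < e / 4 by rewrite divr_gt0.
have [K K0 uK] := ui_excess hF aX ui e4.
have {}uK t : 0 <= t -> \int[P]_w excess K (X t w) <= e / 4.
  move=> t0; rewrite -lee_fin -Rintegral_fineK//; first exact: uK.
  exact/L1_excess/martingale_L1.
(* The mesh h of the grid divides 2 K and is at most e / 4. *)
set N := (Num.truncn ((K + K) / (e / 4))).+1; set h := (K + K) / N%:R.
have N0 : (0 : R) < N%:R by rewrite ltr0n.
have h0 : 0 < h by rewrite divr_gt0// addr_gt0.
have hN : N%:R * h = K + K by rewrite /h mulrC divfK// gt_eqF.
have he : h <= e / 4.
  have /andP[_ /ltW] : (Num.truncn ((K + K) / (e / 4)))%:R <= (K + K) / (e / 4) < N%:R.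
    by apply: Num.Theory.truncn_itv; rewrite divr_ge0 ?addr_ge0 ?ltW.
  by rewrite /h ler_pdivrMr// ler_pdivrMr// mulrC.
pose Phi t := \sum_(i < N.+1) \int[P]_w Num.max (X t w - (i%:R * h - K)) 0.
have iM a t : 0 <= t -> L1 (fun w => Num.max (X t w - a) 0).
  by move=> t0; apply/L1_max0/L1B; [exact: martingale_L1|exact: L1_cst].
set S := [set Phi t | t in [set t | 0 <= t]].
have supS : has_sup S.
  split; first by exists (Phi 0); exists 0 => /=.
  exists (\sum_(i < N.+1) (K + e / 4 + `|i%:R * h - K|)) => _ [t t0 <-].
  apply: ler_sum => i _; set a := _ - K.
  apply: (@le_trans _ _ (\int[P]_w (K + excess K (X t w) + `|a|))).
    have iK : L1 (fun w => K + excess K (X t w)).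
      by apply: L1D; [exact: L1_cst|exact/L1_excess/martingale_L1].
    apply: le_Rintegral => //; [exact: iM| |].
      by apply: L1D => //; exact: L1_cst.
    move=> w _; have := norm_le_excess K (X t w); have := ler_norm (X t w).
    have := ler_norm (- a); rewrite normrN ge_max => ? ? ?.
    by have := normr_ge0 (X t w); have := normr_ge0 a; lra.
  have iE : L1 (fun w => excess K (X t w)) by exact/L1_excess/martingale_L1.
  rewrite RintegralD//; [|by apply: L1D => //; exact: L1_cst|exact: L1_cst].
  rewrite RintegralD//; last exact: L1_cst.
  by rewrite !mean_cst lerD2r lerD2l uK.
have [_ [s s0 <-] sS] := sup_adherent e4 supS.
exists s => // t st; have t0 := le_trans s0 st.
have := cond_mean_dist (filtration_sigma_algebra hF s0)
  (fun A => filtration_measurable hF s0) (martingale_cond_mean s0 st) (ltW K0) h0 hN.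
rewrite -/(Phi t) -/(Phi s).
have : Phi t <= sup S by apply: ub_le_sup; [by case: supS|exists t].
have := uK _ s0; have := uK _ t0.
lra.
Qed.

Definition dyadic_exceed (a h : R) : set T :=
  [set w | exists p i, h < `|X (dyadic a p i) w - X a w| ].

(** Doob's maximal inequality.  For a fixed mesh, the event is split according to
    the first exceedance time, whose event is known at that time; the norm of
    X - X a does not decrease in mean on it later on.  As the meshes are refined, the
    events increase. *)
Lemma maximal_dyadic a e h : 0 <= a -> 0 < h ->
  (forall t, a <= t -> \int[P]_w `|X t w - X a w| <= e) ->
  measurable (dyadic_exceed a h) /\ (P (dyadic_exceed a h) <= (e / h)%:E)%E.
Proof.
move=> a0 h0 ae.
pose E p i : set T := [set w | h < `|X (dyadic a p i) w - X a w| ].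
have dy0 p i : 0 <= dyadic a p i by rewrite (le_trans a0)// dyadic_ge.
have aX : adapted F X by case: mX.
have iX p i : L1 (fun w => X (dyadic a p i) w - X a w).
  by apply: L1B; apply: martingale_L1.
have FE p i : F (dyadic a p i) (E p i).
  apply: (subsigma_gt (filtration_sigma_algebra hF (dy0 p i)) h
    (f := fun w => `|X (dyadic a p i) w - X a w|)).
  apply: measurableT_comp => //; apply: measurable_funB; first exact: aX.
  by apply: (adapted_mono hF aX) => //; exact: dyadic_ge.
have mE p i : measurable (E p i) := filtration_measurable hF (dy0 p i) (FE p i).
have -> : dyadic_exceed a h = \bigcup_p \bigcup_i E p i.
  by apply/seteqP; split => w [p]; [move=> [i Ei]|move=> _ [i _ Ei]]; exists p => //; exists i.
have mU p : measurable (\bigcup_i E p i) by exact: bigcupT_measurable.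
split; first exact: bigcupT_measurable.
have PE p : (P (\bigcup_i E p i) <= (e / h)%:E)%E.
  have FD i : F (dyadic a p i) (seqDU (E p) i).
    have sF := filtration_sigma_algebra hF (dy0 p i).
    apply: subsigmaD => //.
    suff : forall j, (j <= i)%N -> F (dyadic a p i) (\big[setU/set0]_(k < j) E p k).
      by apply.
    elim=> [_|j IHj ji].
      by rewrite big_ord0; exact: subsigma0.
    rewrite big_ord_recr /=; apply: (subsigmaU sF); first exact/IHj/ltnW.
    by apply: filtration_le (FE p j) => //; exact/le_dyadic/ltnW.
  have mD i : measurable (seqDU (E p) i) := filtration_measurable hF (dy0 p i) (FD i).
  rewrite seqDU_bigcup_eq measure_bigcup//; rewrite (eq_eseriesl (Q := xpredT) _ _ (@in_setT _)).
  apply: lime_le; first exact: is_cvg_nneseries.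
  apply: nearW => n.
  rewrite (eq_bigr _ (fun i _ => probability_fineK P (mD i))).
  rewrite big_mkord sumEFin lee_fin ler_pdivlMr// mulr_suml.
  apply: le_trans (ae (dyadic a p n) (dyadic_ge _ _ _)).
  apply: le_trans (sum_Rintegral_le n (@trivIset_seqDU _ (E p)) mD (L1_norm (iX p n)) _) => //.
  apply: ler_sum => i _.
  have sF := filtration_sigma_algebra hF (dy0 p i).
  have UV : cond_mean P (F (dyadic a p i)) (fun w => X (dyadic a p n) w - X a w)
      (fun w => X (dyadic a p i) w - X a w).
    apply: cond_mean_sub => //.
    - by move=> A; exact: filtration_measurable.
    - by apply: martingale_cond_mean => //; exact/le_dyadic/ltnW.
    - by apply: (adapted_mono hF aX) => //; exact: dyadic_ge.
    - exact: martingale_L1.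
  apply: le_trans (cond_mean_norm sF _ UV (FD i)); last first.
    by move=> A; exact: filtration_measurable.
  rewrite mulrC -Rintegral_cst//; apply: le_Rintegral => //.
  - exact/L1S/L1_cst.
  - exact/L1S/L1_norm.
  - by move=> w [/ltW].
have : (P \o (fun p => \bigcup_i E p i)) p @[p --> \oo] --> P (\bigcup_p \bigcup_i E p i).
  apply: nondecreasing_cvg_mu => //; first exact: bigcupT_measurable.
  move=> p q pq; apply/subsetPset => w [i _ Ei].
  by exists (2 ^ (q - p) * i)%N => //; rewrite /E /= -dyadic_refine.
move=> cP; rewrite -(cvg_lim _ cP)//; apply: lime_le; first exact/cvg_ex/ex_intro/cP.
by apply: nearW => p; exact: PE.
Qed.

Lemma dyadic_exceed_ae h : uniformly_integrable P X -> 0 < h ->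
  {ae P, forall w, exists2 a, 0 <= a & ~ dyadic_exceed a h w}.
Proof.
move=> ui h0.
have /choice[a ha] : forall k : nat, exists a, [/\ 0 <= a, measurable (dyadic_exceed a h) &
    (P (dyadic_exceed a h) <= (k.+1%:R^-1)%:E)%E].
  move=> k; have e0 : 0 < h / k.+1%:R by rewrite divr_gt0.
  have [a a0 ae] := martingale_L1_cauchy ui e0.
  exists a; have [? Pa] := maximal_dyadic a0 h0 ae; split => //.
  by apply: le_trans Pa _; rewrite lee_fin mulrAC divff ?gt_eqF// mul1r.
exists (\bigcap_k dyadic_exceed (a k) h); split.
- by apply: bigcapT_measurable => k; have [] := ha k.
- apply/eqP; rewrite eq_le measure_ge0 andbT; apply/lee_addgt0Pr => e e0.
  have [k _ /(_ _ (leqnn k)) ke] := near_infty_natSinv_lt (PosNum e0).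
  have [_ mk Pk] := ha k; rewrite add0e.
  apply: le_trans (le_trans Pk _); last by rewrite lee_fin ltW.
  apply: le_measure; rewrite ?inE//; last exact: bigcap_inf.
  by apply: bigcapT_measurable => j; have [] := ha j.
move=> w /= nw k _; apply: contrapT => na; apply: nw.
by exists (a k) => //; have [] := ha k.
Qed.

(** By right-continuity, a path that never exceeds its value at a by more than h at
    the dyadic times after a stays within h of it at all times, which makes almost
    every path Cauchy. *)
Lemma ui_martingale_limit_exists : as_right_continuous P X ->
  uniformly_integrable P X -> limit_exists P X.
Proof.
move=> rc ui.
have h0 (j : nat) : 0 < j.+1%:R^-1 :> R by rewrite invr_gt0.
move: (ae_foralln (fun j => dyadic_exceed_ae ui (h0 j))) rc.
apply: filterS2 => w small rcw.
apply: (@cauchy_cvg R (X t w @[t --> +oo%R])); apply: cauchy_exP => e e0.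
have [j _ /(_ _ (leqnn j)) je] := near_infty_natSinv_lt (PosNum e0).
have [a a0 na] := small j.
exists (X a w); exists a; split; first exact: num_real.
move=> t /ltW at_ /=; rewrite /ball /= distrC; apply: le_lt_trans je.
rewrite leNgt; apply/negP => jt; apply: na.
have oA : open [set y : R | j.+1%:R^-1 < `|y - X a w| ].
  rewrite (_ : [set _ | _] = (fun y : R => `|y - X a w|) @^-1` [set y | j.+1%:R^-1 < y])//.
  apply: open_comp; last exact: open_gt.
  by move=> y _; apply: cvg_norm; apply: cvgB; [exact: cvg_id|exact: cvg_cst].
have [p [i [_ Api]]] := dyadic_right_approx at_ (rcw t (le_trans a0 at_)) oA jt.
by exists p, i.
Qed.

End uniformly_integrable_martingale.

(** * Optional stopping *)

Section countable_partition.
Context (d : measure_display) (T : measurableType d) (R : realType).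
Variable P : probability T R.
Variables (D : nat -> set T) (tD : trivIset setT D) (mD : forall i, measurable (D i)).
Implicit Types (f g : T -> R).
Local Notation L1 f := (P.-integrable setT (EFin \o f)).
Local Notation U := (\bigcup_i D i).

Let mU : measurable U. Proof. exact: bigcupT_measurable. Qed.

Lemma partition_measurable f (g : nat -> T -> R) h :
  (forall i, measurable_fun setT (g i)) -> measurable_fun setT h ->
  (forall i w, D i w -> f w = g i w) -> (forall w, ~ U w -> f w = h w) ->
  measurable_fun setT f.
Proof.
move=> mg mh fg fh; rewrite -(setUv U); apply/measurable_funU => //.
  exact: measurableC.
split.
  apply/measurable_fun_bigcup => // i.
  by apply: eq_measurable_fun (measurable_funTS (mg i)) => w /set_mem Dw; rewrite (fg i).
by apply: eq_measurable_fun (measurable_funTS mh) => w /set_mem Uw; rewrite fh.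
Qed.

Lemma partition_integral_le (f g : T -> R) :
  measurable_fun setT f -> measurable_fun setT g ->
  (forall w, 0 <= f w) -> (forall w, 0 <= g w) ->
  (forall i, \int[P]_(w in D i) (f w)%:E <= \int[P]_(w in D i) (g w)%:E)%E ->
  (forall w, ~ U w -> f w = g w) ->
  (\int[P]_w (f w)%:E <= \int[P]_w (g w)%:E)%E.
Proof.
move=> mf mg f0 g0 fg fgU; have mCU := measurableC mU.
have split_ (h : T -> R) : measurable_fun setT h -> (forall w, 0 <= h w) ->
    (\int[P]_w (h w)%:E = \sum_(0 <= i <oo) \int[P]_(w in D i) (h w)%:E
                          + \int[P]_(w in ~` U) (h w)%:E)%E.
  move=> mh h0; have mEh : measurable_fun setT (EFin \o h) by apply/measurable_EFinP.
  rewrite -(setUv U) integral_setU//; last 2 first.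
  - by rewrite setUv.
  - by apply/disj_setPS; rewrite setICr.
  rewrite ge0_integral_bigcup//; first exact: measurable_funTS.
  by move=> w _; rewrite lee_fin.
rewrite !split_//; apply: leeD.
  by apply: lee_nneseries => [i _ _|i _]; first by apply: integral_ge0 => w _; rewrite lee_fin.
rewrite le_eqVlt; apply/orP; left; apply/eqP/eq_integral => w /set_mem Uw.
by rewrite fgU.
Qed.

Lemma partition_Rintegral_eq f g : L1 f -> L1 g ->
  (forall i, \int[P]_(w in D i) f w = \int[P]_(w in D i) g w) ->
  (forall w, ~ U w -> f w = g w) ->
  \int[P]_w f w = \int[P]_w g w.
Proof.
move=> if_ ig fg fgU; rewrite !(Rintegral_setC mU)//; congr (_ + _); last first.
  by apply: eq_Rintegral => w /set_mem Uw; rewrite fgU.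
congr fine; rewrite !integral_bigcup//; [|exact: L1S|exact: L1S].
by apply: eq_eseriesr => i _; rewrite !Rintegral_fineK// fg.
Qed.

End countable_partition.

Section optional_stopping.
Context (d : measure_display) (T : measurableType d) (R : realType).
Variables (P : probability T R) (F : R -> set (set T)) (hF : filtration F).
Variable X : R -> T -> R.
Implicit Types (A : set T) (e K s t : R) (tau : T -> \bar R).
Local Notation L1 f := (P.-integrable setT (EFin \o f)).

(** The limit at infinity closes the martingale: the mean of X n over A is
    constant as soon as n is larger than t, for A in F t, and passes to the limit
    by uniform integrability. *)
Lemma ui_martingale_closed : martingale P F X -> uniformly_integrable P X ->
  limit_exists P X ->
  exists Z, {ae P, forall w, X_infty X w = Z w} /\
    forall t, 0 <= t -> cond_mean P (F t) Z (X t).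
Proof.
move=> mX ui lX; have [aX iX _] := mX.
have cX t : 0 <= t -> {ae P, forall w, X (t + n%:R) w @[n --> \oo] --> X_infty X w}.
  move=> t0; apply: filterS lX => w lw.
  apply: (cvg_comp (fun n => t + n%:R) (fun s => X s w)) lw.
  apply/cvgryPge => B; near=> n; rewrite -lerBlDl; near: n; exact: nbhs_infty_ger.
have mXn t n : 0 <= t -> measurable_fun setT (X (t + n%:R)).
  by move=> t0; apply: (adapted_measurable hF aX); rewrite addr_ge0.
have [Z mZ XZ] := ae_limit_version (fun n => mXn 0 n (lexx 0)) (cX 0 (lexx 0)).
exists Z; split => //.
have closed t A : 0 <= t -> F t A ->
    L1 (Z \_ A) /\ \int[P]_(w in A) X t w = \int[P]_(w in A) Z w.
  move=> t0 FA; have mA := filtration_measurable hF t0 FA.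
  have mr (f : T -> R) : measurable_fun setT f -> measurable_fun setT (f \_ A).
    by move=> mf; apply/(measurable_restrictT _ mA)/measurable_funTS.
  have [||//||iZ EZ] := @ui_ae_limit _ _ _ P (fun n => X (t + n%:R) \_ A) (Z \_ A).
  - by move=> n; apply/mr/mXn.
  - exact: mr.
  - move: (cX t t0) XZ; apply: filterS2 => w cw Zw.
    by rewrite /patch -Zw; case: ifPn => // _; exact: cvg_cst.
  - move=> e e0; have [K K0 uK] := ui_excess hF aX ui e0; exists K; first exact: ltW.
    move=> n; apply: le_trans (uK (t + n%:R) _); last by rewrite addr_ge0.
    apply: ge0_le_integral => //.
    + by move=> w _; rewrite lee_fin excess_ge0.
    + by apply/measurable_EFinP/measurable_excess/mr/mXn.
    + by apply/measurable_EFinP/measurable_excess/mXn.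
    move=> w _; rewrite lee_fin /patch; case: ifPn => // _.
    by rewrite /excess normr0 max_r ?le_max ?lexx ?orbT// sub0r oppr_le0 ltW.
  split => //; rewrite [RHS]Rintegral_mkcond; apply/esym/EZ => n.
  rewrite -Rintegral_mkcond.
  have tn : t <= t + n%:R by rewrite lerDl.
  by have [_ _ _ ->] := martingale_cond_mean hF mX t0 tn.
move=> t t0; split.
- exact: aX.
- exact: iX.
- have [] := closed 0 setT (lexx 0) (subsigmaT (filtration_sigma_algebra hF (lexx 0))).
  by rewrite patch_setT.
- by move=> A FA; have [] := closed t A t0 FA.
Unshelve. all: end_near.
Qed.

Lemma stopping_time_lt tau t : stopping_time F tau -> 0 <= t ->
  F t [set w | (tau w < t%:E)%E].
Proof.
move=> [tau0 st] t0; have sF := filtration_sigma_algebra hF t0.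
have [t_gt0|t_le0] := ltP 0 t; last first.
  rewrite (_ : [set _ | _] = set0); first exact: subsigma0.
  apply/seteqP; split => // w /= wt; have := le_lt_trans (tau0 w) wt.
  by rewrite lte_fin ltNge t_le0.
pose s j := Num.max 0 (t - j.+1%:R^-1).
have s0 j : 0 <= s j by rewrite le_max lexx.
have st_ j : s j < t by rewrite gt_max t_gt0/= ltrBlDr ltrDl invr_gt0.
rewrite (_ : [set _ | _] = \bigcup_j [set w | (tau w <= (s j)%:E)%E]).
  by apply: subsigma_bigcup => // j; apply: filtration_le (st _ (s0 j)) => //; exact: ltW.
apply/seteqP; split => w /=; last first.
  by move=> [j _ /= wj]; apply: le_lt_trans wj _; rewrite lte_fin.
case E : (tau w) (tau0 w) => [r| |]//= r0; rewrite lte_fin => rt.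
have rt0 : 0 < t - r by rewrite subr_gt0.
have [j _ /(_ _ (leqnn j)) /= jr] := near_infty_natSinv_lt (PosNum rt0).
by exists j => //=; rewrite E lee_fin le_max lerBrDr -lerBrDl (ltW jr) orbT.
Qed.

Definition grid_time (n k : nat) : R := k%:R / n.+1%:R.

(** The process is read at a grid time strictly after tau, so that right-continuity
    gives the limit as the mesh tends to 0. *)
Definition grid_stopped (Z : T -> R) tau n w : R :=
  if tau w is r%:E then X (grid_time n (Num.truncn (r * n.+1%:R)).+1) w else Z w.

Definition grid_event tau n k : set T :=
  [set w | (tau w < (grid_time n k.+1)%:E)%E] `\` [set w | (tau w < (grid_time n k)%:E)%E].

Lemma grid_time_ge0 n k : 0 <= grid_time n k.
Proof. by rewrite divr_ge0. Qed.

Lemma grid_event_filtration tau n k : stopping_time F tau ->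
  F (grid_time n k.+1) (grid_event tau n k).
Proof.
move=> st; have sF := filtration_sigma_algebra hF (grid_time_ge0 n k.+1).
apply: subsigmaD => //; first exact: stopping_time_lt (grid_time_ge0 _ _).
apply: filtration_le (stopping_time_lt st (grid_time_ge0 _ _)) => //.
  exact: grid_time_ge0.
by rewrite ler_pM2r ?invr_gt0// ler_nat.
Qed.

Lemma grid_eventP tau n k w : stopping_time F tau ->
  grid_event tau n k w <-> exists2 r, tau w = r%:E & Num.truncn (r * n.+1%:R) = k.
Proof.
move=> [tau0 _]; rewrite /grid_event /grid_time /=.
have n0 : 0 < n.+1%:R :> R by [].
case E : (tau w) (tau0 w) => [r| |]//= r0.
  rewrite !lte_fin ltr_pdivlMr// ltr_pdivlMr//; split.
    move=> [rk1 /negP]; rewrite -leNgt => rk; exists r => //.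
    by apply: Num.Theory.truncn_def; rewrite rk.
  move=> [_ [<-] <-].
  have /andP[r1 r2] := Num.Theory.truncn_itv (mulr_ge0 r0 (ltW n0)).
  by split => //; apply/negP; rewrite -leNgt.
by split; [rewrite ltNge leey => -[]|move=> []].
Qed.

Lemma grid_event_trivIset tau n : stopping_time F tau ->
  trivIset setT (grid_event tau n).
Proof.
move=> st; apply/trivIsetP => i j _ _ ij; apply/seteqP; split => // w [].
move=> /(grid_eventP _ _ _ st)[r Er Ei] /(grid_eventP _ _ _ st)[s]; rewrite Er => -[<-].
by rewrite Ei => /eqP; rewrite (negbTE ij).
Qed.

(** On each grid event, X is the conditional mean of Z at a deterministic time.
    Summing over these events bounds the excess of the approximation by that of Z,
    uniformly in the mesh, and identifies its mean; then the mesh tends to 0. *)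
Lemma optional_stopping tau : martingale P F X -> uniformly_integrable P X ->
  as_right_continuous P X -> stopping_time F tau ->
  in_L1_with_mean P (stopped X tau) 'E_P[X 0].
Proof.
move=> mX ui rc st; have [aX iX _] := mX.
have lX := ui_martingale_limit_exists hF mX rc ui.
have [Z [XZ cZ]] := ui_martingale_closed mX ui lX.
have [_ iX0 iZ _] := cZ 0 (lexx 0).
have mZ := L1_measurable iZ.
pose f := grid_stopped Z tau.
have g0 := grid_time_ge0.
have mX_ t : 0 <= t -> measurable_fun setT (X t) by exact: (adapted_measurable hF aX).
have mD n k : measurable (grid_event tau n k).
  exact: filtration_measurable (grid_event_filtration n k st).
have tD n : trivIset setT (grid_event tau n) by exact: grid_event_trivIset.
have fX n k w : grid_event tau n k w -> f n w = X (grid_time n k.+1) w.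
  by move=> /(grid_eventP _ _ _ st)[r Er <-]; rewrite /f /grid_stopped Er.
have fZ n w : ~ (\bigcup_k grid_event tau n k) w -> f n w = Z w.
  move=> nD; rewrite /f /grid_stopped; case E : (tau w) => [r| |]//; case: nD.
  by exists (Num.truncn (r * n.+1%:R)) => //; apply/(grid_eventP _ _ _ st); exists r.
have mf n : measurable_fun setT (f n).
  apply: (partition_measurable (mD n) _ mZ (fX n) (fZ n)) => k; exact: mX_.
have fEZ n K : 0 <= K ->
    (\int[P]_w (excess K (f n w))%:E <= \int[P]_w (excess K (Z w))%:E)%E.
  move=> K0; apply: (partition_integral_le (tD n) (mD n)).
  - exact: measurable_excess.
  - exact: measurable_excess.
  - by move=> w; exact: excess_ge0.
  - by move=> w; exact: excess_ge0.
  - move=> k; have s0 := g0 n k.+1.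
    rewrite (_ : \int[P]_(w in _) _ =
      \int[P]_(w in grid_event tau n k) (excess K (X (grid_time n k.+1) w))%:E)%E; last first.
      by apply: eq_integral => w /set_mem /fX ->.
    have [_ iXs _ _] := cZ _ s0.
    rewrite !Rintegral_fineK//; [|exact: L1_excess|exact: L1_excess].
    rewrite lee_fin; apply: (cond_mean_excess (filtration_sigma_algebra hF s0) _ (cZ _ s0)) => //.
      by move=> A; exact: filtration_measurable.
    exact: grid_event_filtration.
  - by move=> w /fZ ->.
have if_ n : L1 (f n).
  have E0 (x : R) : excess 0 x = `|x| by rewrite /excess subr0 max_l.
  have := fEZ n 0 (lexx 0).
  rewrite [X in (_ <= X)%E]Rintegral_fineK//; last exact: L1_excess.
  under eq_integral do rewrite E0.
  move=> fle; apply/integrableP; split; first exact/measurable_EFinP.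
  exact: le_lt_trans fle (ltry _).
have fcvg : {ae P, forall w, f n w @[n --> \oo] --> stopped X tau w}.
  move: rc XZ; apply: filterS2 => w rcw Zw; rewrite /f /grid_stopped /stopped.
  case E : (tau w) (st.1 w) => [r| |]//= r0; last by rewrite Zw; exact: cvg_cst.
  rewrite lee_fin in r0.
  have /cvg_at_rightP rcr := rcw r r0.
  have n0 n : 0 < n.+1%:R :> R by [].
  have u_itv n : r < grid_time n (Num.truncn (r * n.+1%:R)).+1 <= r + n.+1%:R^-1.
    rewrite /grid_time.
    have /andP[r1 r2] := Num.Theory.truncn_itv (mulr_ge0 r0 (ltW (n0 n))).
    rewrite ltr_pdivlMr// r2 -natr1 mulrDl mul1r lerD2r ler_pdivrMr//.
  apply: (rcr (fun n => grid_time n (Num.truncn (r * n.+1%:R)).+1)); split.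
    by move=> n; have /andP[] := u_itv n.
  apply/cvgrPdist_le => e e0; apply: filterS (near_infty_natSinv_lt (PosNum e0)) => n /= ne.
  have /andP[u1 u2] := u_itv n.
  rewrite ltr0_norm ?subr_lt0// opprB lerBlDl; apply: le_trans u2 _.
  by rewrite lerD2l ltW.
have [h mh fh] := ae_limit_version mf fcvg.
have [||ih Eh] := @ui_ae_limit _ _ _ P f h mf mh.
- by move: fcvg fh; apply: filterS2 => w cw <-.
- move=> e e0; have [K K0 ZK] := excess_mean_small iZ e0; exists K => // n.
  apply: le_trans (fEZ n K K0) _; rewrite Rintegral_fineK//; exact: L1_excess.
exists h; split => //.
rewrite unlock !Rintegral_fineK//; congr _%:E.
apply: Eh => n.
have -> : \int[P]_w X 0 w = \int[P]_w Z w.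
  have [_ _ _ -> //] := cZ 0 (lexx 0).
  exact: subsigmaT (filtration_sigma_algebra hF (lexx 0)).
apply: (partition_Rintegral_eq (tD n) (mD n)) => // [k|w]; last exact: fZ.
have s0 := g0 n k.+1.
have [_ _ _ <-] := cZ _ s0; last exact: grid_event_filtration.
by apply: eq_Rintegral => w /set_mem /fX.
Qed.

End optional_stopping.

(** * Switching between stopping times *)

Section stopping_to_martingale.
Context (d : measure_display) (T : measurableType d) (R : realType).
Variables (P : probability T R) (F : R -> set (set T)) (hF : filtration F).
Variable X : R -> T -> R.
Implicit Types (A : set T) (e K s t : R) (tau : T -> \bar R).
Local Notation L1 f := (P.-integrable setT (EFin \o f)).

Lemma in_L1_with_mean_version (Z : T -> R) m : in_L1_with_mean P Z m ->
  exists Y, [/\ L1 Y, {ae P, forall w, Z w = Y w} & (\int[P]_w Y w)%:E = m].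
Proof.
move=> [Y [iY ZY]]; rewrite unlock => EY; exists Y; split => //.
by rewrite -Rintegral_fineK.
Qed.

Lemma stopping_time_cst t : 0 <= t -> stopping_time F (fun=> t%:E).
Proof.
move=> t0; split=> [w|s s0]; first by rewrite lee_fin.
have sF := filtration_sigma_algebra hF s0.
have [ts|st] := leP t s.
  rewrite (_ : [set _ | _] = setT); first exact: subsigmaT.
  by apply/seteqP; split => // w _ /=; rewrite lee_fin.
rewrite (_ : [set _ | _] = set0); first exact: subsigma0.
by apply/seteqP; split => // w /=; rewrite lee_fin leNgt st.
Qed.

Lemma stopping_time_infty : stopping_time F (fun=> +oo%E).
Proof.
split=> // s s0; rewrite (_ : [set _ | _] = set0).
  exact: subsigma0 (filtration_sigma_algebra hF s0).
by apply/seteqP; split => // w /=; rewrite leNgt ltry.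
Qed.

Definition switch A t tau w : \bar R := if w \in A then t%:E else tau w.

Lemma stopping_time_switch A t tau : stopping_time F tau -> 0 <= t -> F t A ->
  (forall w, t%:E <= tau w)%E -> stopping_time F (switch A t tau).
Proof.
move=> [tau0 st] t0 FA ttau; split=> [w|s s0].
  by rewrite /switch; case: ifPn => // _; rewrite lee_fin.
have sF := filtration_sigma_algebra hF s0.
have [ts|st_] := leP t s.
  rewrite (_ : [set _ | _] = A `|` [set w | (tau w <= s%:E)%E]).
    by apply: subsigmaU => //; [exact: filtration_le FA|exact: st].
  apply/seteqP; split => w; rewrite /switch /=; case: ifPn => [/set_mem|/negP] Aw.
  - by left.
  - by right.
  - by rewrite lee_fin.
  - by move=> [/mem_set|].
rewrite (_ : [set _ | _] = set0); first exact: subsigma0.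
apply/seteqP; split => // w; rewrite /switch /=; case: ifPn => _.
  by rewrite lee_fin leNgt st_.
by move=> /(le_trans (ttau w)); rewrite lee_fin leNgt st_.
Qed.

(** Stopping at t on A and at tau elsewhere has the same mean as stopping at tau,
    so that X t and X tau have the same mean on A. *)
Lemma switch_mean A t tau m (V : T -> R) : measurable A -> L1 (X t) ->
  L1 V -> {ae P, forall w, stopped X tau w = V w} -> (\int[P]_w V w)%:E = m ->
  in_L1_with_mean P (stopped X (switch A t tau)) m ->
  \int[P]_(w in A) X t w = \int[P]_(w in A) V w.
Proof.
move=> mA iX iV XV EV /in_L1_with_mean_version[W [iW XW EW]].
have [mX mV mW] := And3 (L1_measurable iX) (L1_measurable iV) (L1_measurable iW).
have : \int[P]_w W w = \int[P]_w V w by apply: EFin_inj; rewrite EV.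
rewrite !(Rintegral_setC mA)//.
rewrite (@ae_eq_Rintegral _ _ _ P A W (X t))//; last first.
  by apply: filterS XW => w + Aw; rewrite /stopped /switch mem_set.
rewrite (@ae_eq_Rintegral _ _ _ P (~` A) W V)//; last 2 first.
- exact: measurableC.
- move: XW XV; apply: filterS2 => w + + nAw.
  by rewrite /stopped /switch memNset// => <- <-.
by move/addIr.
Qed.

End stopping_to_martingale.

(** * Stopping times at which the process is dominated *)

Section running_min.
Context (R : realType) (T : Type).
Implicit Types (u : nat -> T -> R).

Fixpoint running_min u n w : R :=
  if n is k.+1 then Num.min (running_min u k w) (u n w) else u 0 w.

Lemma running_min_le u n i w : (i <= n)%N -> running_min u n w <= u i w.
Proof.
elim: n => [|n IHn]; first by rewrite leqn0 => /eqP ->.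
rewrite leq_eqVlt => /predU1P[->|]; first by rewrite /= ge_min lexx orbT.
by rewrite ltnS => /IHn ?; rewrite /= ge_min; apply/orP; left.
Qed.

Lemma running_min_attained u n w : exists2 i, (i <= n)%N & running_min u n w = u i w.
Proof.
elim: n => [|n [i ni IHn]]; first by exists 0%N.
rewrite /=; case: leP => _; first by exists i => //; exact: leqW.
by exists n.+1.
Qed.

End running_min.

Lemma measurable_running_min (R : realType) d (T : measurableType d)
    (u : nat -> T -> R) n : (forall i, (i <= n)%N -> measurable_fun setT (u i)) ->
  measurable_fun setT (running_min u n).
Proof.
elim: n => [|n IHn] mu; first exact: mu.
apply: measurable_minr; last exact: mu.
by apply: IHn => i ni; exact/mu/leqW.
Qed.

Section finite_stopping_to_martingale.
Context (d : measure_display) (T : measurableType d) (R : realType).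
Variables (P : probability T R) (F : R -> set (set T)) (hF : filtration F).
Variable X : R -> T -> R.
Implicit Types (A : set T) (e K s t : R) (tau : T -> \bar R).
Local Notation L1 f := (P.-integrable setT (EFin \o f)).

(** As the times u k i increase in the lexicographic order, the first pair (k, i)
    that is hit gives the earliest time.  The hit occurs by time t exactly if some
    event of a time before t occurs, which is a countable union. *)
Lemma first_hit (u : nat -> nat -> R) (n : nat -> nat) (H : nat -> nat -> set T) :
  (forall k i, 0 <= u k i) ->
  (forall k i j, (i <= j)%N -> u k i <= u k j) ->
  (forall k l i j, (k < l)%N -> (i <= n k)%N -> u k i <= u l j) ->
  (forall k i, (i <= n k)%N -> F (u k i) (H k i)) ->
  exists2 sigma : T -> \bar R, stopping_time F sigma &
    forall w, (sigma w = +oo%E /\ forall k i, (i <= n k)%N -> ~ H k i w) \/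
      exists k i, [/\ (i <= n k)%N, H k i w & sigma w = (u k i)%:E].
Proof.
move=> u0 umono ulex FH.
pose first w x := (x = +oo%E /\ forall k i, (i <= n k)%N -> ~ H k i w) \/
  exists k i, [/\ (i <= n k)%N, H k i w, x = (u k i)%:E &
    forall l j, (j <= n l)%N -> H l j w -> u k i <= u l j].
have /choice[sigma hs] : forall w, exists x, first w x.
  move=> w.
  have [[k [i [ki Hki]]]|none] := pselect (exists k i, (i <= n k)%N /\ H k i w); last first.
    by exists +oo%E; left; split => // k i ki Hki; apply: none; exists k, i.
  have exk : exists k, `[< exists2 i, (i <= n k)%N & H k i w >].
    by exists k; apply/asboolP; exists i.
  have [{ki Hki}k /asboolP[{}i ki Hki] kmin] := ex_minnP exk.
  have exi : exists i, `[< (i <= n k)%N /\ H k i w >] by exists i; apply/asboolP.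
  have [{ki Hki}{}i /asboolP[ki Hki] imin] := ex_minnP exi.
  exists (u k i)%:E; right; exists k, i; split => // l j lj Hlj.
  have : (k <= l)%N by apply: kmin; apply/asboolP; exists j.
  rewrite leq_eqVlt => /predU1P[kl|kl]; last exact: ulex.
  by rewrite -kl in lj Hlj *; apply: umono; apply: imin; apply/asboolP.
exists sigma; last first.
  by move=> w; have [|[k [i [? ? ? _]]]] := hs w; [left|right; exists k, i].
split => [w|t t0].
  have [[-> _]|[k [i [_ _ -> _]]]] := hs w; first exact: leey.
  by rewrite lee_fin.
have sF := filtration_sigma_algebra hF t0.
rewrite (_ : [set _ | _] = \bigcup_k \bigcup_i
    (if (i <= n k)%N && (u k i <= t) then H k i else set0)).
  apply: subsigma_bigcup => // k; apply: subsigma_bigcup => // i.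
  case: ifPn => [/andP[ki ut]|_]; last exact: subsigma0.
  exact: filtration_le (FH k i ki).
apply/seteqP; split => w /=.
  have [[-> _]|[k [i [ki Hki -> _]]]] := hs w; first by rewrite leNgt ltry.
  by rewrite lee_fin => ut; exists k => //; exists i => //; rewrite ki ut.
move=> [k _ [i _]]; case: ifPn => // /andP[ki ut] Hki.
have [[_ /(_ k i ki)]//|[l [j [_ _ -> jmin]]]] := hs w.
by rewrite lee_fin (le_trans _ ut)// jmin.
Qed.

Lemma liminf_abs_attained w (l e a : R) : liminf_abs X w = l%:E -> 0 < e ->
  exists2 t, a <= t & `|X t w| < l + e.
Proof.
move=> Xl e0; apply: contrapT => no.
suff : ((l + e)%:E <= liminf_abs X w)%E by rewrite Xl lee_fin; lra.
rewrite /liminf_abs limf_einfE.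
apply: (@le_trans _ _ (ereal_inf [set `|X t w|%:E | t in [set t | a < t]])); last first.
  apply: ereal_sup_ubound; exists [set t | a < t] => //.
  by apply: nbhs_pinfty_gt; exact: num_real.
apply: le_ereal_inf_tmp => _ [t /= at_ <-]; rewrite lee_fin leNgt; apply/negP => lt.
by apply: no; exists t => //; exact: ltW.
Qed.

Lemma liminf_abs_eventually w (l e : R) : liminf_abs X w = l%:E -> 0 < e ->
  exists a, forall t, a < t -> l - e < `|X t w|.
Proof.
move=> Xl e0.
have : ((l - e)%:E < liminf_abs X w)%E by rewrite Xl lte_fin; lra.
rewrite /liminf_abs limf_einfE => /ereal_sup_gt[_ [V [a [_ aV]] <-] Vl].
exists a => t at_; rewrite -lte_fin; apply: lt_le_trans Vl _.
by apply: ereal_inf_lbound; exists t => //; exact: aV.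
Qed.

Definition level_min a p : T -> R :=
  running_min (fun i w => `|X (dyadic a p i) w|) (4 ^ p).

Definition level_err (l : T -> R) a p w : R := Num.max (level_min a p w - l w) 0.

Section domination.
Hypotheses (aX : adapted F X) (iX : forall t, 0 <= t -> L1 (X t)).
Hypothesis rc : as_right_continuous P X.
Variables (l : T -> R) (il : L1 l).
Hypothesis Xl : {ae P, forall w, liminf_abs X w = (l w)%:E}.

Lemma measurable_level_min a p : 0 <= a -> measurable_fun setT (level_min a p).
Proof.
move=> a0; apply: measurable_running_min => i _; apply: measurableT_comp => //.
by apply: (adapted_measurable hF aX); rewrite (le_trans a0)// dyadic_ge.
Qed.

Lemma L1_level_err a p : 0 <= a -> L1 (level_err l a p).
Proof.
move=> a0; apply/L1_max0/L1B => //.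
apply: (L1_le (measurable_level_min p a0) (L1_norm (iX a0))) => w.
have [i _ Ei] := running_min_attained (fun i w => `|X (dyadic a p i) w|) (4 ^ p) w.
rewrite ger0_norm /level_min; last by rewrite Ei.
rewrite (le_trans (running_min_le _ w (leq0n _)))//.
by rewrite /dyadic mul0r addr0.
Qed.

(** The infimum of |X| after a is at most the limit inferior, and is approximated
    by the minima over ever finer dyadic grids. *)
Lemma level_err_cvg0 a : 0 <= a ->
  {ae P, forall w, level_err l a p w @[p --> \oo] --> (0 : R)}.
Proof.
move=> a0; move: rc Xl; apply: filterS2 => w rcw Xlw.
apply/cvgrPdist_le => e e0.
have [t at_ Xt] := liminf_abs_attained a Xlw e0.
have oA : open [set y : R | `|y| < l w + e].
  rewrite (_ : [set _ | _] = (@Num.norm _ R) @^-1` [set y | y < l w + e])//.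
  by apply: open_comp; [move=> y _; exact: norm_continuous|exact: open_lt].
have [p [i [ip Xi]]] := dyadic_right_approx at_ (rcw t (le_trans a0 at_)) oA Xt.
exists p => // q /= pq.
rewrite sub0r normrN ger0_norm /level_err ?le_max ?lexx ?orbT// ge_max (ltW e0) andbT.
rewrite lerBlDl; apply: ltW; apply: le_lt_trans Xi.
rewrite (dyadic_refine _ _ pq).
apply: (@running_min_le _ _ (fun i w => `|X (dyadic a q i) w|)).
rewrite -[in leqRHS](subnKC pq) expnD mulnC leq_mul//.
by case: (q - p)%N => // r; rewrite leq_exp2r.
Qed.

Lemma level_err_small a e : 0 <= a -> 0 < e ->
  exists p, \int[P]_w level_err l a p w <= e.
Proof.
move=> a0 e0.
have me p : measurable_fun setT (EFin \o level_err l a p).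
  by have /integrableP[] := L1_level_err p a0.
have iD : L1 (fun w => `|X a w| + `|l w|) by apply: L1D; apply: L1_norm => //; exact: iX.
have [||_ _] := @dominated_convergence _ _ _ P _ measurableT _ (cst 0%E) _
    me (measurable_cst _) _ iD _.
- by apply: filterS (level_err_cvg0 a0) => w cw _; apply: cvg_EFin; [exact: nearW|].
- apply/aeW => w p _; rewrite lee_fin ger0_norm /level_err ?le_max ?lexx ?orbT//.
  rewrite ge_max addr_ge0// andbT.
  apply: lerD; last by rewrite -normrN ler_norm.
  rewrite (le_trans (running_min_le _ w (leq0n _)))//.
  by rewrite /dyadic mul0r addr0.
rewrite integral_cst//= mul0e => /fine_cvg/cvgrPdist_le/(_ _ e0)[n _ /(_ _ (leqnn n))].
rewrite /= sub0r normrN => /(le_trans (ler_norm _)) ne.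
by exists n.
Qed.

(** The levels are consecutive blocks of time.  The minimum m k of |X| over the grid
    of block k exceeds l by at most e k, with summable means, so that m k tends to l
    almost surely.  Hence, at some k after any given one, m k.+1 <= m k + 1, and the
    threshold m k + 1, known when block k.+1 begins, is reached in that block.  The
    first time when this happens is the stopping time, and there |X| is at most
    l + e k + 1, hence at most D = |l| + \sum_k e k + 1, whatever the time t from
    which the search starts. *)
Lemma liminf_domination : exists2 D, L1 D &
  forall t, 0 <= t -> exists sigma, [/\ finite_stopping_time P F sigma,
    forall w, (t%:E <= sigma w)%E &
    {ae P, forall w, `|stopped X sigma w| <= D w}].
Proof.
have err_bound (k : nat) : 0 < 1 / (2 ^ k.+1)%:R :> R.
  by rewrite divr_gt0// ltr0n expn_gt0.
have /choice[rank rankP] : forall ak : R * nat, exists p, 0 <= ak.1 ->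
    \int[P]_w level_err l ak.1 p w <= 1 / (2 ^ ak.2.+1)%:R.
  move=> [a k]; have [a0|_] := leP 0 a; last by exists 0%N.
  by have [p] := level_err_small a0 (err_bound k); exists p.
(* A block starts one unit after the last grid time of the previous block, so that
   the blocks exhaust the time axis. *)
pose next (k : nat) (a : R) := dyadic a (rank (a, k)) (4 ^ rank (a, k)) + 1.
pose start := fix start k : R := if k is j.+1 then next j (start j) else 0.
pose rk k := rank (start k, k).
pose u k i := dyadic (start k) (rk k) i.
pose n k := (4 ^ rk k)%N.
pose m k := level_min (start k) (rk k).
pose e k := level_err l (start k) (rk k).
have startS k : start k.+1 = u k (n k) + 1 by [].
have start_ge k : k%:R <= start k.
  elim: k => [//|k IHk]; rewrite startS -natr1 lerD2r (le_trans IHk)//.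
  exact: dyadic_ge.
have start0 k : 0 <= start k by rewrite (le_trans _ (start_ge k)).
have u0 k i : 0 <= u k i by rewrite (le_trans (start0 k))// dyadic_ge.
have umono k i j : (i <= j)%N -> u k i <= u k j by exact: le_dyadic.
have start_mono : {homo start : k j / (k <= j)%N >-> k <= j}.
  apply: homo_leq => //; first exact: le_trans.
  move=> k; rewrite startS (le_trans (dyadic_ge _ (rk k) (n k)))// lerDl//.
have ulex k j i i' : (k < j)%N -> (i <= n k)%N -> u k i <= u j i'.
  move=> kj ik; apply: (@le_trans _ _ (start k.+1)); last first.
    by rewrite (le_trans (start_mono _ _ kj))// dyadic_ge.
  by rewrite startS (le_trans (umono _ _ _ ik))// lerDl.
have e0 k w : 0 <= e k w by rewrite le_max lexx orbT.
have ie k : L1 (e k) by exact: L1_level_err.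
have m_attained k w : exists2 i, (i <= n k)%N & m k w = `|X (u k i) w|.
  exact: running_min_attained.
have me_le k w : m k w <= l w + e k w by rewrite -lerBlDl le_max lexx.
pose S w := (\sum_(0 <= k <oo) (e k w)%:E)%E.
have me k : measurable_fun setT (fun w => (e k w)%:E) by have /integrableP[] := ie k.
have e0E k w : (0 <= (e k w)%:E)%E by rewrite lee_fin.
have mS : measurable_fun setT S by apply: ge0_emeasurable_sum.
have S0 w : (0 <= S w)%E by exact: nneseries_ge0.
have iS : P.-integrable setT S.
  apply/integrableP; split => //.
  under eq_integral do rewrite gee0_abs//.
  rewrite integral_nneseries//.
  apply: (@le_lt_trans _ _ (1%:E)%E); last exact: ltry.
  apply: le_trans (epsilon_trick0 xpredT ler01).
  apply: lee_nneseries => [k _ _|k _]; first exact: integral_ge0.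
  rewrite (Rintegral_fineK measurableT (ie k)) lee_fin.
  exact: rankP (start k, k) (start0 k).
have eS k w : ((e k w)%:E <= S w)%E.
  rewrite /S (nneseries_split 0%N k.+1)//.
  rewrite big_nat_recr//= -addeA addeC -[leLHS]adde0 -addeA leeD2l//.
  by rewrite adde_ge0// ?sume_ge0 ?nneseries_ge0.
have Sfin := integrable_ae measurableT iS.
pose D w := `|l w| + fine (S w) + 1.
have iD : L1 D.
  apply: L1D; last exact: L1_cst.
  apply: L1D; first exact: L1_norm.
  apply: le_integrable iS => //.
    by apply/measurable_EFinP/(measurableT_comp _ mS)/fine_measurable.
  move=> w _ /=; rewrite ger0_norm ?fine_ge0// gee0_abs//.
  by case: (S w) (S0 w).
exists D => // t t0.
(* Block k0 starts after t, and the search is restricted to the blocks after k0. *)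
set k0 := (Num.truncn t).+1.
pose u' k i := u (k0 + k).+1 i.
pose n' k := n (k0 + k).+1.
pose H k i : set T := [set w | `|X (u' k i) w| <= m (k0 + k)%N w + 1].
have FH k i : (i <= n' k)%N -> F (u' k i) (H k i).
  move=> ik; have sF := filtration_sigma_algebra hF (u0 (k0 + k).+1 i).
  have mm : measurable_fun setT (m (k0 + k)%N : g_sigma_algebraType (F (u' k i)) -> R).
    apply: measurable_running_min => j jn; apply: measurableT_comp => //.
    by apply: (adapted_mono hF aX); [exact: u0|exact: ulex].
  have mf : measurable_fun setT ((fun w => `|X (u' k i) w| - m (k0 + k)%N w) :
      g_sigma_algebraType (F (u' k i)) -> R).
    apply: measurable_funB => //; apply: measurableT_comp => //; exact: (aX (u0 _ _)).
  rewrite (_ : H k i = ~` [set w | 1 < `|X (u' k i) w| - m (k0 + k)%N w]).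
    by apply: subsigmaC => //; exact: subsigma_gt.
  apply/seteqP; split => w; rewrite /H /= ltrBrDl; first by rewrite leNgt => /negP.
  by move/negP; rewrite -leNgt.
have [||||sigma st hs] := @first_hit u' n' H.
- by move=> k i; exact: u0.
- by move=> k; exact: umono.
- by move=> k j i i' kj; apply: ulex; rewrite ltnS ltn_add2l.
- exact: FH.
have hit : {ae P, forall w, exists k i, (i <= n' k)%N /\ H k i w}.
  move: Xl Sfin; apply: filterS2 => w Xlw Sw.
  have half0 : 0 < 1 / 2 :> R by lra.
  have [a Xa] := liminf_abs_eventually Xlw half0.
  have Slty : (\sum_(0 <= k <oo) (e k w)%:E < +oo)%E by rewrite ltey_eq Sw.
  have tail0 := nneseries_tail_cvg Slty (fun k _ => e0E k w).
  have [N _ tailN] : \forall N \near \oo, (\sum_(N <= k <oo) (e k w)%:E < (1 / 2)%:E)%E.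
    apply: (tail0 [set x : \bar R | (x < (1 / 2)%:E)%E]); apply: open_nbhs_nbhs.
    by split; [exact: open_ereal_lt_ereal|rewrite /= lte_fin].
  have eN k : (N <= k)%N -> e k w < 1 / 2.
    move=> /tailN /=; rewrite -lte_fin; apply: le_lt_trans.
    rewrite (nneseries_split k 1)// addn1 big_nat1 -[leLHS]adde0 leeD2l//.
    exact: nneseries_ge0.
  pose k := maxn N (Num.truncn a).+1.
  have mK : l w - 1 / 2 < m (k0 + k)%N w.
    have [i _ ->] := m_attained (k0 + k)%N w.
    apply: Xa; apply: lt_le_trans (dyadic_ge _ _ _); apply: lt_le_trans (start_ge _).
    apply: (@lt_le_trans _ _ (Num.truncn a).+1%:R); first exact: Num.Theory.truncnS_gt.
    by rewrite ler_nat (leq_trans (leq_maxr N _))// leq_addl.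
  have [i ni Ei] := m_attained (k0 + k).+1 w.
  exists k, i; split => //; rewrite /H /= /u' -Ei.
  have : m (k0 + k).+1 w <= l w + e (k0 + k).+1 w := me_le _ _.
  have : e (k0 + k).+1 w < 1 / 2.
    by apply: eN; rewrite (leq_trans (leq_maxl _ (Num.truncn a).+1))// leqW// leq_addl.
  lra.
exists sigma; split.
- split=> //; apply: filterS hit => w [k [i [ki Hki]]].
  by have [[_ /(_ k i ki)]//|[k' [i' [_ _ ->]]]] := hs w; exact: ltry.
- move=> w; have [[-> _]|[k [i [_ _ ->]]]] := hs w; first by rewrite leey.
  rewrite lee_fin (le_trans _ (dyadic_ge _ _ _))// (le_trans _ (start_ge _))//.
  have /andP[_ /ltW/le_trans] := Num.Theory.truncn_itv t0; apply.
  by rewrite ler_nat leqW// leq_addr.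
move: hit Sfin; apply: filterS2 => w [k0' [i0 [ki0 Hk0]]] Sw.
have [[_ /(_ _ _ ki0)]//|[k [i [ki Hki Ew]]]] := hs w.
rewrite /stopped Ew (le_trans Hki)// /D lerD2r (le_trans (me_le _ _))//.
apply: lerD; first exact: ler_norm.
by rewrite -lee_fin fineK//; exact: Sw.
Qed.

End domination.

(** Switching from a constant time gives the martingale property, and switching from
    a time at which X is dominated gives uniform integrability. *)
Lemma finite_stopping_martingale : adapted F X -> as_right_continuous P X ->
  (forall tau, finite_stopping_time P F tau ->
     in_L1_with_mean P (stopped X tau) 'E_P[X 0]) ->
  in_L1 P (liminf_abs X) -> martingale P F X /\ uniformly_integrable P X.
Proof.
move=> aX rc os [Y iY XY].
have finite_cst t : 0 <= t -> finite_stopping_time P F (fun=> t%:E).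
  by move=> t0; split; [exact: stopping_time_cst|apply/aeW => w; exact: ltry].
have iX t : 0 <= t -> L1 (X t).
  move=> t0; have [V [iV XV _]] := in_L1_with_mean_version (os _ (finite_cst t t0)).
  exact: (L1_ae (adapted_measurable hF aX t0) iV XV).
have closed t tau : 0 <= t -> finite_stopping_time P F tau -> (forall w, (t%:E <= tau w)%E) ->
    exists2 V, {ae P, forall w, stopped X tau w = V w} & cond_mean P (F t) V (X t).
  move=> t0 ft ttau; have [V [iV XV EV]] := in_L1_with_mean_version (os _ ft).
  exists V => //; split; [exact: aX|exact: iX|exact: iV|move=> A FA].
  apply: (switch_mean _ (iX t t0) iV XV EV); first exact: filtration_measurable FA.
  apply: os; split; first by apply: stopping_time_switch => //; exact: ft.1.
  by apply: filterS ft.2 => w; rewrite /switch; case: ifPn => // _ _; exact: ltry.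
have mX : martingale P F X.
  split => // s t s0 st; have t0 := le_trans s0 st.
  have sT A (FA : F s A) := filtration_measurable hF s0 FA.
  apply/(cond_meanP sT _ (iX t t0)).
  have [|V XV [_ _ iV EV]] := closed s _ s0 (finite_cst t t0); first by move=> w; rewrite lee_fin.
  split; [exact: aX|exact: iX|exact: iX|move=> A FA].
  rewrite EV//; apply: ae_eq_Rintegral; first exact: sT.
  - exact: L1_measurable iV.
  - exact: (adapted_measurable hF aX t0).
  by apply: filterS XV => w <-.
split=> //.
pose l w := fine (Y w).
have /integrableP[mY _] := iY.
have il : L1 l.
  apply: le_integrable iY => //.
    by apply/measurable_EFinP; exact: (measurableT_comp (fine_measurable measurableT) mY).
  by move=> w _; rewrite /= /l; case: (Y w) => [r| |] //=; rewrite normr0 leey.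
have Xl : {ae P, forall w, liminf_abs X w = (l w)%:E}.
  move: XY (integrable_ae measurableT iY); apply: filterS2 => w XYw Yw.
  by rewrite XYw /l fineK//; exact: Yw.
have [D iD XD] := liminf_domination aX iX rc il Xl.
apply: (dominated_ui hF aX iD iX) => t A t0 FA.
have [sigma [fsigma tsigma sD]] := XD t t0.
have [V XV cV] := closed t sigma t0 fsigma tsigma.
have [_ _ iV _] := cV.
have sF := filtration_sigma_algebra hF t0.
have FT B (FB : F t B) := filtration_measurable hF t0 FB.
apply: le_trans (cond_mean_norm sF FT cV FA) _.
rewrite -lee_fin -!Rintegral_fineK; [|exact: FT|exact: L1_norm|exact: FT|exact: L1_norm].
apply: ae_ge0_le_integral => //; first exact: FT.
- by have /integrableP[/(measurable_funTS (D := A))] := L1_norm iV.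
- by have /integrableP[/(measurable_funTS (D := A))] := L1_norm iD.
move: XV sD; apply: filterS2 => w <- Dw _; rewrite lee_fin.
exact: le_trans Dw (ler_norm _).
Qed.

Lemma cvg_liminf_abs w (x : R) : X t w @[t --> +oo%R] --> x ->
  liminf_abs X w = `|x|%:E.
Proof.
move=> /cvg_norm Xx; rewrite /liminf_abs limf_einfE; apply/eqP; rewrite eq_le; apply/andP; split.
  apply: ge_ereal_sup => _ [V FV <-]; apply/lee_addgt0Pr => e e0.
  have /cvgrPdist_lt/(_ _ e0) Xe := Xx.
  have [t [Vt Xt]] := filter_ex (filterI FV Xe).
  apply: (@le_trans _ _ `|X t w|%:E); first by apply: ereal_inf_lbound; exists t.
  by rewrite -EFinD lee_fin; move: Xt; rewrite /= ltr_norml; lra.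
apply/lee_subgt0Pr => e e0.
have /cvgrPdist_lt/(_ _ e0) Xe := Xx.
apply: le_trans (ereal_sup_ubound _); last by eexists; [exact: Xe|reflexivity].
apply: le_ereal_inf_tmp => _ [t /= Xt <-].
by rewrite -EFinB lee_fin; move: Xt; rewrite ltr_norml; lra.
Qed.

Lemma limit_liminf_L1 V : limit_exists P X -> L1 V ->
  {ae P, forall w, X_infty X w = V w} -> in_L1 P (liminf_abs X).
Proof.
move=> lX iV XV; exists (fun w => `|V w|%:E); first exact: L1_norm.
by move: lX XV; apply: filterS2 => w lw <-; exact: cvg_liminf_abs.
Qed.

End finite_stopping_to_martingale.

Theorem theorem1 (d : measure_display) (T : measurableType d) (R : realType)
    (P : probability T R) (F : R -> set (set T)) (X : R -> T -> R)
    (hF : filtration F) (hX : progressive F X)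
    (hrc : as_right_continuous P X) :
  let I := martingale P F X /\ uniformly_integrable P X in
  let II := limit_exists P X /\
    forall tau : T -> \bar R, stopping_time F tau ->
      in_L1_with_mean P (stopped X tau) 'E_P[X 0] in
  let III :=
    (forall tau : T -> \bar R, finite_stopping_time P F tau ->
      in_L1_with_mean P (stopped X tau) 'E_P[X 0]) /\
    in_L1 P (liminf_abs X) in
  (I <-> II) /\ (II <-> III).
Proof.
move=> I II III; have aX := progressive_adapted hX.
have I_II : I -> II.
  move=> [mX ui]; split; first exact (ui_martingale_limit_exists hF mX hrc ui).
  by move=> tau; exact: optional_stopping.
have II_III : II -> III.
  move=> [lX os]; split; first by move=> tau [st _]; exact: os.
  have [V [iV XV _]] := in_L1_with_mean_version (os _ (stopping_time_infty hF)).
  exact: limit_liminf_L1 lX iV XV.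
have III_I : III -> I by move=> [os lX]; exact: finite_stopping_martingale.
split; split; [exact: I_II|move=> /II_III; exact: III_I|exact: II_III|].
by move=> /III_I; exact: I_II.
Qed.
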